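(* Let $n$ be a fixed odd number and let $\Omega$ be an axially symmetric slice domain in $\mathbb{R}^{n+1}$. Then a slice monogenic function $f:\Omega\to\mathbb{R}_n$ satisfies $\Delta_{\mathbb{R}^{n+1}}^{\frac{n-1}{2}}f=0$ on $\Omega$ if and only if $f$ is an $\mathbb{R}_n$-valued polynomial in the variable $x$ of the form $$f(x)=\sum_{k=0}^{n-2}x^k\alpha_k,\qquad \alpha_k\in\mathbb{R}_n.$$
   Context: $\mathbb{R}_n$ is the real Clifford algebra generated by $e_1,\dots,e_n$ with $e_\ell e_m+e_me_\ell=0$ for $\ell\ne m$ and $e_\ell^2=-1$. A point $(x_0,\dots,x_n)\in\mathbb{R}^{n+1}$ is identified with the paravector $x=x_0+\underline{x}$, $\underline{x}=\sum_{\ell=1}^n x_\ell e_\ell$. $\mathbb{S}^{n-1}=\{\underline{x}:x_1^2+\dots+x_n^2=1\}$ and $\mathbb{C}_I=\{u+Iv:u,v\in\mathbb{R}\}$ for $I\in\mathbb{S}^{n-1}$ (note $I^2=-1$). $\Delta_{\mathbb{R}^{n+1}}=\sum_{i=0}^n\partial_{x_i}^2$. An axially symmetric slice domain is a domain $\Omega\subseteq\mathbb{R}^{n+1}$ with $\Omega\cap\mathbb{R}\neq\emptyset$, with $\Omega\cap\mathbb{C}_I$ a domain in $\mathbb{C}_I$ for every $I\in\mathbb{S}^{n-1}$, and such that $u+Iv\in\Omega$ for some $I\in\mathbb{S}^{n-1}$ implies $u+Jv\in\Omega$ for all $J\in\mathbb{S}^{n-1}$. A function $f:\Omega\to\mathbb{R}_n$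 is (left) slice monogenic if for every $I\in\mathbb{S}^{n-1}$ its restriction to $\Omega\cap\mathbb{C}_I$ is holomorphic, i.e. continuously differentiable with $(\partial_u+I\partial_v)f(u+Iv)=0$. *)

(* Defs.v *)
From HB Require Import structures.
From mathcomp Require Import all_boot all_order all_algebra.
From mathcomp Require Import all_classical all_reals all_analysis.
From mathcomp Require Import ring.

Set Implicit Arguments.
Unset Strict Implicit.
Unset Printing Implicit Defensive.

Import Order.TTheory GRing.Theory Num.Theory.
Import numFieldNormedType.Exports.

Local Open Scope set_scope.
Local Open Scope ring_scope.

(* The Clifford algebra is the space of coordinate vectors indexed by the     *)
(* subsets A of {0, .., n-1}, the A-th basis vector being                     *)
(* e_A = e_{i_1} * ... * e_{i_k} for A = {i_1 < ... < i_k}.                   *)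
(* The generators e_1, .., e_n are indexed here by 'I_n.                      *)
Definition clifford (R : realType) (n : nat) : Type :=
  'rV[R]_#|{: {set 'I_n}}|.

HB.instance Definition _ (R : realType) (n : nat) :=
  NormedModule.on (clifford R n).
HB.instance Definition _ (R : realType) (n : nat) := Complete.on (clifford R n).

Section CliffordAlgebra.
Context {R : realType} {n : nat}.
Local Notation C := (clifford R n).
Implicit Types (A B D : {set 'I_n}) (x y z : C) (l m : 'I_n).

Definition cliff_coord A x : R := (x : 'rV_ _) ord0 (enum_rank A).

Definition blade A : C := delta_mx ord0 (enum_rank A) : 'rV_ _.

Definition sdiff A B : {set 'I_n} := (A :\: B) :|: (B :\: A).

(* In e_A * e_B, moving a factor e_j (j in B) to the left past each e_i with  *)
(* i in A and j < i costs a sign, and so does e_j ^ 2 = -1 if j is in A.      *)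
Definition blade_sign A B : R :=
  (-1) ^+ #|[set p : 'I_n * 'I_n | [&& p.1 \in A, p.2 \in B & (p.2 <= p.1)%N]]|.

Definition cliff_one : C := blade finset.set0.

Definition cliff_mul x y : C :=
  \sum_A \sum_B
    (blade_sign A B * cliff_coord A x * cliff_coord B y) *: blade (sdiff A B).

Lemma coordE A B : cliff_coord B (blade A) = (A == B)%:R.
Proof.
by rewrite /cliff_coord /blade mxE eqxx /= (inj_eq enum_rank_inj) eq_sym.
Qed.

Lemma coord_is_linear A : linear (cliff_coord A : C -> R).
Proof. by move=> a x y; rewrite /cliff_coord !mxE. Qed.

HB.instance Definition _ A :=
  GRing.isLinear.Build R C R *%R (cliff_coord A) (@coord_is_linear A).

Lemma coordP x y : (forall A, cliff_coord A x = cliff_coord A y) -> x = y.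
Proof.
move=> h; apply/rowP => i; have := h (enum_val i).
by rewrite /cliff_coord enum_valK.
Qed.

Lemma blade_decomp x : x = \sum_A cliff_coord A x *: blade A.
Proof.
apply: coordP => D; rewrite linear_sum (bigD1 D) //= big1 => [|A /negbTE nAD].
  by rewrite linearZ /= coordE eqxx mulr1 addr0.
by rewrite linearZ /= coordE nAD mulr0.
Qed.

Lemma in_sdiff A B l : (l \in sdiff A B) = (l \in A) (+) (l \in B).
Proof. by rewrite !inE; case: (l \in A); case: (l \in B). Qed.

Lemma sdiffA A B D : sdiff A (sdiff B D) = sdiff (sdiff A B) D.
Proof. by apply/setP => l; rewrite !in_sdiff addbA. Qed.

Lemma sdiff0l A : sdiff finset.set0 A = A.
Proof. by apply/setP => l; rewrite in_sdiff inE. Qed.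

Lemma sdiff0r A : sdiff A finset.set0 = A.
Proof. by apply/setP => l; rewrite in_sdiff inE addbF. Qed.

Lemma blade_signE A B : blade_sign A B =
  \prod_(p : 'I_n * 'I_n | (p.2 <= p.1)%N)
     (-1) ^+ ((p.1 \in A) && (p.2 \in B)).
Proof.
rewrite /blade_sign -prodr_const.
rewrite (eq_bigl (fun p : 'I_n * 'I_n =>
  (p.2 <= p.1)%N && ((p.1 \in A) && (p.2 \in B)))).
  by rewrite big_mkcondr; apply: eq_bigr => p _; case: (_ && _).
by move=> p; rewrite !inE andbA andbC.
Qed.

Lemma blade_sign_sdiffl A B D :
  blade_sign (sdiff A B) D = blade_sign A D * blade_sign B D.
Proof.
rewrite !blade_signE -big_split /=; apply: eq_bigr => p _.
rewrite in_sdiff -signr_addb; congr (_ ^+ _).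
by case: (p.1 \in A); case: (p.1 \in B); case: (p.2 \in D).
Qed.

Lemma blade_sign_sdiffr A B D :
  blade_sign A (sdiff B D) = blade_sign A B * blade_sign A D.
Proof.
rewrite !blade_signE -big_split /=; apply: eq_bigr => p _.
rewrite in_sdiff -signr_addb; congr (_ ^+ _).
by case: (p.1 \in A); case: (p.2 \in B); case: (p.2 \in D).
Qed.

Lemma blade_sign0l A : blade_sign finset.set0 A = 1.
Proof. by rewrite blade_signE big1 // => p _; rewrite inE. Qed.

Lemma blade_sign0r A : blade_sign A finset.set0 = 1.
Proof. by rewrite blade_signE big1 // => p _; rewrite inE andbF. Qed.

Lemma cliff_mulDl : left_distributive cliff_mul +%R.
Proof.
move=> x y z; rewrite /cliff_mul -big_split; apply: eq_bigr => A _ /=.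
rewrite -big_split; apply: eq_bigr => B _ /=.
by rewrite linearD /= mulrDr mulrDl scalerDl.
Qed.

Lemma cliff_mulDr : right_distributive cliff_mul +%R.
Proof.
move=> x y z; rewrite /cliff_mul -big_split; apply: eq_bigr => A _ /=.
rewrite -big_split; apply: eq_bigr => B _ /=.
by rewrite linearD /= mulrDr scalerDl.
Qed.

Lemma cliff_mulZl (a : R) x y : cliff_mul (a *: x) y = a *: cliff_mul x y.
Proof.
rewrite /cliff_mul scaler_sumr; apply: eq_bigr => A _.
rewrite scaler_sumr; apply: eq_bigr => B _.
by rewrite linearZ /= scalerA mulrCA !mulrA.
Qed.

Lemma cliff_mulZr (a : R) x y : cliff_mul x (a *: y) = a *: cliff_mul x y.
Proof.
rewrite /cliff_mul scaler_sumr; apply: eq_bigr => A _.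
rewrite scaler_sumr; apply: eq_bigr => B _.
by rewrite linearZ /= scalerA mulrCA.
Qed.

Lemma cliff_mul_blade A B :
  cliff_mul (blade A) (blade B) = blade_sign A B *: blade (sdiff A B).
Proof.
rewrite /cliff_mul (bigD1 A) //= [X in _ + X]big1 ?addr0 => [|D nDA]; last first.
  rewrite big1 // => D' _.
  by rewrite coordE eq_sym (negbTE nDA) mulr0 mul0r scale0r.
rewrite (bigD1 B) //= big1 ?addr0 => [|D nDB].
  by rewrite !coordE !eqxx !mulr1.
by rewrite (coordE B D) eq_sym (negbTE nDB) mulr0 scale0r.
Qed.

Lemma blade_ind (P : C -> Prop) :
  (forall (a : R) A, P (a *: blade A)) ->
  (forall x y, P x -> P y -> P (x + y)) -> forall x, P x.
Proof.
move=> PZ PD x; rewrite (blade_decomp x); elim/big_ind: _ => //.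
by rewrite -(scale0r (blade finset.set0)).
Qed.

Lemma cliff_mulA : associative cliff_mul.
Proof.
move=> x y z; elim/blade_ind: x => [a A|u v hu hv]; last first.
  by rewrite !cliff_mulDl hu hv.
elim/blade_ind: y => [b B|u v hu hv]; last first.
  by rewrite cliff_mulDl !cliff_mulDr cliff_mulDl hu hv.
elim/blade_ind: z => [c D|u v hu hv]; last first.
  by rewrite !cliff_mulDr hu hv.
rewrite !(cliff_mulZl, cliff_mulZr, cliff_mul_blade) !scalerA.
rewrite sdiffA blade_sign_sdiffl blade_sign_sdiffr; congr (_ *: _).
by ring.
Qed.

Lemma cliff_mul1l : left_id cliff_one cliff_mul.
Proof.
elim/blade_ind=> [a A|u v hu hv]; last by rewrite cliff_mulDr hu hv.
by rewrite cliff_mulZr cliff_mul_blade blade_sign0l scale1r sdiff0l.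
Qed.

Lemma cliff_mul1r : right_id cliff_one cliff_mul.
Proof.
elim/blade_ind=> [a A|u v hu hv]; last by rewrite cliff_mulDl hu hv.
by rewrite cliff_mulZl cliff_mul_blade blade_sign0r scale1r sdiff0r.
Qed.

Lemma cliff_one_neq0 : cliff_one != 0.
Proof.
apply/eqP => /(congr1 (cliff_coord finset.set0)); rewrite linear0 coordE eqxx.
by move/eqP; rewrite oner_eq0.
Qed.

HB.instance Definition _ := GRing.Zmodule_isNzRing.Build C
  cliff_mulA cliff_mul1l cliff_mul1r cliff_mulDl cliff_mulDr cliff_one_neq0.

HB.instance Definition _ := GRing.Lmodule_isLalgebra.Build R C
  (fun a x y => esym (cliff_mulZl a x y)).

HB.instance Definition _ := GRing.Lalgebra_isAlgebra.Build R C
  (fun a x y => esym (cliff_mulZr a x y)).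

Definition gen l : C := blade [set l].

Lemma mul_blade A B : blade A * blade B = blade_sign A B *: blade (sdiff A B).
Proof. exact: cliff_mul_blade. Qed.

Lemma blade_sign1 l m : blade_sign [set l] [set m] = (-1) ^+ (m <= l)%N.
Proof.
rewrite /blade_sign (_ : [set p | _] =
  if (m <= l)%N then [set (l, m)] else finset.set0).
  by case: leqP; rewrite ?cards1 ?cards0.
apply/setP => -[i j]; rewrite !inE /=; case: (leqP m l) => h; rewrite !inE.
  by rewrite xpair_eqE; case: eqP => //= ->; case: eqP => //= ->; rewrite h.
by case: eqP => //= ->; case: eqP => //= ->; rewrite leqNgt h.
Qed.

Lemma gen_sqr l : gen l * gen l = -1.
Proof.
rewrite /gen mul_blade blade_sign1 leqnn expr1 scaleN1r; congr (- _).
by congr blade; apply/setP => i; rewrite in_sdiff addbb inE.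
Qed.

Lemma gen_anticomm l m : l != m -> gen l * gen m + gen m * gen l = 0.
Proof.
move=> lm; rewrite /gen !mul_blade !blade_sign1.
rewrite (_ : sdiff [set m] [set l] = sdiff [set l] [set m]); last first.
  by apply/setP => i; rewrite !in_sdiff addbC.
rewrite -scalerDl -(inj_eq val_inj) /= in lm *.
by case: ltngtP lm => // _ _; rewrite ?expr0 ?expr1 ?subrr ?addNr scale0r.
Qed.

Lemma blade_prod A : blade A = \prod_(l <- enum A) gen l.
Proof.
have sub_sdiff l (B : {set 'I_n}) : (forall i, i \in B -> (l < i)%N) ->
    gen l * blade B = blade (l |: B).
  move=> lB; rewrite /gen mul_blade (_ : blade_sign _ _ = 1) ?scale1r.
    congr blade; apply/setP => i; rewrite in_sdiff !inE.
    case: eqP => // ->.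
    by case: (boolP (l \in B)) => // /lB; rewrite ltnn.
  rewrite blade_signE big1 // => -[i j] /= ji; rewrite inE.
  case: eqP => // il; case jB: (j \in B) => //.
  by have := lB _ jB; rewrite -il ltnNge ji.
have sorted_prod (s : seq 'I_n) : sorted (fun i j : 'I_n => i < j)%N s ->
    \prod_(l <- s) gen l = blade [set l in s].
  elim: s => [|l s IHs] ls.
    by rewrite big_nil; congr blade; apply/setP => i; rewrite !inE.
  rewrite big_cons IHs ?(path_sorted ls)// sub_sdiff ?set_cons//.
  move=> i; rewrite inE => si.
  have /andP[/allP/(_ _ si)//] : all (fun k : 'I_n => l < k)%N s &&
      sorted (fun i j : 'I_n => i < j)%N s.
    by rewrite -path_sortedE// => ? ? ?; exact: ltn_trans.
rewrite sorted_prod.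
  by congr blade; apply/setP => i; rewrite inE mem_enum.
rewrite /enum_mem sorted_filter // => [? ? ?|]; first exact: ltn_trans.
rewrite -enumT -[sorted _ _]/(sorted (relpre val ltn) (enum 'I_n)).
rewrite -path.sorted_map.
by rewrite val_enum_ord iota_ltn_sorted.
Qed.

End CliffordAlgebra.

Local Close Scope set_scope.
Local Open Scope classical_set_scope.

Section SliceMonogenic.
Context {R : realType} {n : nat}.
Local Notation point := 'rV[R]_n.+1.
Implicit Types (x I J : point) (u v : R) (Omega : set point).

Definition paravector x : clifford R n :=
  (x ord0 ord0)%:A + \sum_(l < n) x ord0 (lift ord0 l) *: gen l.

Definition basis_vec (i : 'I_n.+1) : point := delta_mx ord0 i.

Definition unit_sphere : set point :=
  [set I | I ord0 ord0 = 0 /\ \sum_(l < n) I ord0 (lift ord0 l) ^+ 2 = 1].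

(* The point u + I v of R^(n+1). *)
Definition slice_pt I u v : point := u *: basis_vec ord0 + v *: I.

(* The intersection of Omega with C_I, in the real coordinates (u, v) of C_I. *)
Definition slice Omega I : set (R * R) := [set p | Omega (slice_pt I p.1 p.2)].

Definition is_domain (T : topologicalType) (D : set T) : Prop :=
  [/\ open D, connected D & D !=set0].

Definition axially_symmetric_slice_domain Omega : Prop :=
  [/\ is_domain Omega,
      exists u, Omega (u *: basis_vec ord0),
      forall I, unit_sphere I -> is_domain (slice Omega I) &
      forall u v I, unit_sphere I -> Omega (slice_pt I u v) ->
        forall J, unit_sphere J -> Omega (slice_pt J u v)].

Definition continuously_differentiable_on (V W : normedModType R) (D : set V)
    (g : V -> W) : Prop :=
  forall p, D p ->
    differentiable g p /\ forall w : V, {for p, continuous (fun q => 'D_w g q)}.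

Definition slice_restriction (f : point -> clifford R n) I :
  R * R -> clifford R n := fun p => f (slice_pt I p.1 p.2).

(* The values of f outside the open set Omega are irrelevant. *)
Definition slice_monogenic Omega (f : point -> clifford R n) : Prop :=
  forall I, unit_sphere I ->
    continuously_differentiable_on (slice Omega I) (slice_restriction f I) /\
    forall p, slice Omega I p ->
      'D_(1, 0) (slice_restriction f I) p +
        paravector I * 'D_(0, 1) (slice_restriction f I) p = 0.

Definition laplacian (f : point -> clifford R n) : point -> clifford R n :=
  fun x => \sum_(i < n.+1) 'D_(basis_vec i) ('D_(basis_vec i) f) x.

End SliceMonogenic.

(* Main.v *)
From HB Require Import structures.
Require Import Defs.
From mathcomp Require Import all_boot all_order all_algebra.
From mathcomp Require Import all_classical all_reals all_analysis.
From mathcomp Require Import ring lra.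

Import Order.TTheory GRing.Theory Num.Theory.
Import numFieldNormedType.Exports.

Local Open Scope classical_set_scope.
Local Open Scope ring_scope.

Set Implicit Arguments.
Unset Strict Implicit.
Unset Printing Implicit Defensive.

(* On each slice, a slice monogenic [f] is holomorphic for the complex        *)
(* structure given by left multiplication by [I]; by the identity theorem it  *)
(* has the form [f(u + I v) = alpha(u, v) + I beta(u, v)] with [alpha] and    *)
(* [beta] independent of [I] and satisfying the Cauchy-Riemann equations. In  *)
(* the variable [s = v ^ 2], [f = A(u, s) + x_ B(u, s)] where [x_] is the     *)
(* vector part, [4 s A_ss + 2 A_s + A_uu = 0] and                             *)
(* [4 s B_ss + 6 B_s + B_uu = 0], and the Laplacian replaces [(A, B)] by      *)
(* [2 (n - 1)] times [(A_s, B_s)], then by [2 (n - 3)] times the next         *)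
(* [s]-derivatives, and so on. Hence for [m = (n - 1) / 2] the [m]-th power   *)
(* of the Laplacian kills [f] only if [d_s ^ m A = 0]. The differential       *)
(* equation then gives [d_u ^ (2 m) A = 0], so [f] is a polynomial of degree  *)
(* less than [2 m] on a real interval, and everywhere by the identity         *)
(* theorem. Conversely the [m]-th power of the Laplacian lowers the degree in *)
(* the real coordinates by [2 m].                                             *)
(*   The existence of all derivatives and the identity theorem rest on the    *)
(* formula [h'(z) = 1 / (2 pi r) \int h(z + r e^(is)) e^(-is) ds] for a C^1   *)
(* holomorphic [h]: its kernel does not involve [z], so [h'] is as smooth as  *)
(* [h], and it also yields the Cauchy estimates behind the Taylor argument.   *)

(** * Differential calculus *)

(** The forward direction recovers [f] from its values on the real axis. Take [alpha] and [beta] on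
    one slice: the even part in [v], and [- I] times the odd part. For every [J], [alpha + J beta]
    is holomorphic on the slice of [J] and agrees with [f] on the real axis, so it equals [f] there
    by [slice_holomorphic_identity]; this is [slice_representation].

    Off the real axis the two components of [axial_field] solve Euler-Poisson-Darboux equations in
    [(u, s)] with constants [2] and [6] ([even_tower_epd], [odd_tower_epd]). Replacing the second
    [u]-derivative by [s]-derivatives, the Laplacian sends [axial_field j] to [2 n - 2 - 4 j] times
    [axial_field j.+1] ([is_laplacian_axial_field]). For [n = 2 m + 1] the factor is [4 (m - j)],
    nonzero for [j < m], so the hypothesis on [f] forces [axial_field m = 0], and comparing the
    points of [I] and [- I] isolates its even part ([laplacian_kernel_even_part]).

    Read the other way, the same equation expresses two [u]-derivatives by [s]-derivatives, so [2 m]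
    derivatives in [u] kill the even component for [s > 0] ([epd_tower_vanish]). Letting [v] tend to
    [0] carries this to the real axis, where [f = alpha]; there [f] is a polynomial of degree less
    than [2 m = n - 1], and the identity theorem on each slice extends the formula to [Omega]
    ([laplacian_kernel_polynomial]).

    For the converse, a monomial [x ^ k * c] has degree at most [k] in the real coordinates, and
    each Laplacian lowers the degree by two ([deg_lt_monomial], [iter_laplacian_deg_lt]).

    The analytic input is [circle_int_mean], from which [cauchy_riemann_derivative] and
    [identity_theorem] follow. It is proved for pairs of real functions and reaches Clifford values
    one coordinate at a time through [slice_holomorphic_coord]. *)

Section DeriveRules.
Context {R : realType} {V W : normedModType R}.
Implicit Types (f g : V -> W) (k : V -> R) (x v : V).

Lemma is_derive_add f g x v df dg :
  is_derive x v f df -> is_derive x v g dg ->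
  is_derive x v (fun y => f y + g y) (df + dg).
Proof. exact: is_deriveD. Qed.

Lemma is_derive_opp f x v df :
  is_derive x v f df -> is_derive x v (fun y => - f y) (- df).
Proof. exact: is_deriveN. Qed.

Lemma is_derive_scalec (c : R) f x v df :
  is_derive x v f df -> is_derive x v (fun y => c *: f y) (c *: df).
Proof. exact: is_deriveZ. Qed.

Lemma is_derive_const (w : W) x v : is_derive x v (fun=> w) 0.
Proof. exact: is_derive_cst. Qed.

Lemma is_derive_bigsum (I : Type) (r : seq I) (P : pred I) (h : I -> V -> W)
    x v (dh : I -> W) :
  (forall i, P i -> is_derive x v (h i) (dh i)) ->
  is_derive x v (fun y => \sum_(i <- r | P i) h i y) (\sum_(i <- r | P i) dh i).
Proof.
move=> H; elim: r => [|i r IH].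
  by rewrite big_nil; under eq_fun do rewrite big_nil; exact: is_derive_const.
rewrite big_cons; under eq_fun do rewrite big_cons.
by case: ifP => Pi //; apply: is_derive_add => //; exact: H.
Qed.

Lemma is_derive_cvg f x v df : is_derive x v f df <->
  (fun h : R => h^-1 *: (f (h *: v + x) - f x)) @ 0^' --> df.
Proof.
split=> [[/cvg_ex[l fl] <-]|fl].
  by rewrite /derive; move: (fl) => /cvg_lim ->.
by apply: DeriveDef; [apply/cvg_ex; exists df|exact: cvg_lim fl].
Qed.

Lemma is_derive_line f x v df :
  is_derive x v f df <-> is_derive (0 : R) 1 (fun h : R => f (h *: v + x)) df.
Proof.
have e : (fun h : R => h^-1 *: (f ((h *: 1 + 0 : R) *: v + x) - f (0 *: v + x)))
    = (fun h : R => h^-1 *: (f (h *: v + x) - f x)).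
  by apply/funext => h; rewrite addr0 [h%:A]mulr1 scale0r add0r.
split=> h; apply: DeriveDef.
- by rewrite /derivable /= e; case: h.
- by rewrite /derive /= e; case: h.
- by case: h; rewrite /derivable /= e.
- by case: h; rewrite /derive /= e.
Qed.

Lemma is_derive_line_continuous f x v df : is_derive x v f df ->
  (fun h : R => f (h *: v + x)) @ 0^' --> f x.
Proof.
move=> /is_derive_line[/derivable1_diffP h _].
have := differentiable_continuous h.
by move=> /continuous_withinNx; rewrite scale0r add0r.
Qed.

End DeriveRules.

Section DeriveComposition.
Context {R : realType} {V W : normedModType R}.
Implicit Types (f g : V -> W) (k : V -> R) (x v : V).

Lemma is_derive_scale k f x v dk df :
  is_derive x v k dk -> is_derive x v f df ->
  is_derive x v (fun y => k y *: f y) (dk *: f x + k x *: df).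
Proof.
move=> hk hf; apply/is_derive_cvg.
rewrite [X in X @ _](_ : _ = (fun h : R =>
   (h^-1 *: (k (h *: v + x) - k x)) *: f (h *: v + x) +
   k x *: (h^-1 *: (f (h *: v + x) - f x)))); last first.
  apply/funext => h; rewrite scalerA [k x * _]mulrC -!scalerA -scalerDr.
  by congr (_ *: _); rewrite scalerBr scalerBl addrA subrK.
apply: cvgD.
  apply: cvgZ; first by move/is_derive_cvg: hk.
  exact: is_derive_line_continuous hf.
by apply: cvgZl_tmp; move/is_derive_cvg: hf.
Qed.

Lemma is_derive_comp_real (g : R -> W) k x v dk dg :
  is_derive (k x) 1 g dg -> is_derive x v k dk ->
  is_derive x v (fun y => g (k y)) (dk *: dg).
Proof.
move=> [/derivable1_diffP gd gv] /is_derive_line[/derivable1_diffP kd kv].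
apply/is_derive_line.
have e : k (0 *: v + x) = k x by rewrite scale0r add0r.
have gd' : differentiable g (k ((0 : R) *: v + x)) by rewrite e.
have d : differentiable (g \o (fun h : R => k (h *: v + x))) 0.
  exact: differentiable_comp.
apply: DeriveDef; first exact/derivable1_diffP.
rewrite deriveE// diff_comp// /= -[X in 'd g _ X]deriveE//.
rewrite kv e -[X in 'd g (k x) X]mulr1 -[_ * 1]/(dk *: (1 : R)) linearZ /=.
by rewrite -deriveE// gv.
Qed.

End DeriveComposition.

Lemma is_derive_linear {R : realType} {V W X : normedModType R}
    (L : {linear W -> X}) (f : V -> W) (x v : V) df : continuous L ->
  is_derive x v f df -> is_derive x v (fun y => L (f y)) (L df).
Proof.
move=> Lc /is_derive_cvg fd; apply/is_derive_cvg.
rewrite [X in X @ _](_ : _ = (fun h : R =>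
   L (h^-1 *: (f (h *: v + x) - f x)))); last first.
  by apply/funext => h; rewrite linearZ -linearB.
exact: (cvg_comp _ _ fd (Lc df)).
Qed.

Section MeanValue.
Context {R : realType}.
Implicit Types (f df : R -> R) (p q x : R).

Lemma mean_value f df p q :
  (forall x, `|x - p| <= `|q - p| -> is_derive x 1 f (df x)) ->
  exists2 c, `|c - p| <= `|q - p| & f q - f p = df c * (q - p).
Proof.
move=> H; case: (leP p q) => pq.
  have H' x : x \in `]p, q[%R -> is_derive x 1 f (df x).
    by rewrite in_itv/= => /andP[px xq]; apply: H; rewrite !ger0_norm; lra.
  have [|c] := MVT_segment pq H'.
    apply: derivable_within_continuous => x; rewrite in_itv/= => /andP[px xq].
    by have [] : is_derive x 1 f (df x) by apply: H; rewrite !ger0_norm; lra.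
  rewrite in_itv/= => /andP[pc cq] e; exists c => //.
  by rewrite !ger0_norm; lra.
have qp := ltW pq.
have H' x : x \in `]q, p[%R -> is_derive x 1 f (df x).
  by rewrite in_itv/= => /andP[px xq]; apply: H; rewrite !ler0_norm; lra.
have [|c] := MVT_segment qp H'.
  apply: derivable_within_continuous => x; rewrite in_itv/= => /andP[px xq].
  by have [] : is_derive x 1 f (df x) by apply: H; rewrite !ler0_norm; lra.
rewrite in_itv/= => /andP[pc cq] e; exists c => //.
  by rewrite !ler0_norm; lra.
by rewrite -opprB e -mulrN opprB.
Qed.

Lemma constant_of_derive0 f p q :
  (forall x, `|x - p| <= `|q - p| -> is_derive x 1 f 0) -> f q = f p.
Proof.
by move=> /(@mean_value f (fun=> 0))[c _ /eqP]; rewrite mul0r subr_eq0 => /eqP.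
Qed.

Lemma constant_of_derive0_itv f p q : p <= q ->
  (forall x, p <= x <= q -> is_derive x 1 f 0) -> f q = f p.
Proof.
move=> pq H; have H' x : x \in `]p, q[%R -> is_derive x 1 f 0.
  by rewrite in_itv/= => /andP[px xq]; apply: H; rewrite !ltW.
have [|c _ /eqP] := @MVT_segment _ f (fun=> 0) _ _ pq H'.
  apply: derivable_within_continuous => x; rewrite in_itv/= => pxq.
  by have [] := H x pxq.
by rewrite mul0r subr_eq0 => /eqP.
Qed.

End MeanValue.

Section C1Chain.
Context {R : realType}.
Variables (a a1 a2 : R * R -> R) (z : R * R).
Hypothesis a1P : \forall p \near z, is_derive p.1 (1 : R) (fun t => a (t, p.2)) (a1 p).
Hypothesis a2P : \forall p \near z, is_derive p.2 (1 : R) (fun t => a (p.1, t)) (a2 p).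
Hypothesis a1c : {for z, continuous a1}.
Hypothesis a2c : {for z, continuous a2}.

(** Two mean values along the broken line from [z] through [(z.1, y)] to [(x, y)]; continuity of the
    partials at [z] replaces each intermediate value by the value at [z], at a cost of [e / 2]. *)
Lemma partials_increment (e : R) : 0 < e -> \forall p \near z,
  `|a p - a z - ((p.1 - z.1) * a1 z + (p.2 - z.2) * a2 z)| <= e * `|p - z|.
Proof.
move=> e0; have e20 : 0 < e / 2 by rewrite divr_gt0.
have /cvgrPdist_le/(_ _ e20) c1 := a1c.
have /cvgrPdist_le/(_ _ e20) c2 := a2c.
have : \forall p \near z,
    [/\ is_derive p.1 (1 : R) (fun t => a (t, p.2)) (a1 p),
        is_derive p.2 (1 : R) (fun t => a (p.1, t)) (a2 p),
        `|a1 z - a1 p| <= e / 2 & `|a2 z - a2 p| <= e / 2].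
  by near=> p; split; near: p.
move=> /nbhs_ballP[d /= d0 B]; apply/nbhs_ballP; exists d; first exact: d0.
move=> p zxy; case: p zxy => x y zxy.
have [bx by_] : ball z.1 d x /\ ball z.2 d y by [].
have z12 : z = (z.1, z.2) by case: z.
rewrite /ball/= in bx by_.
have [s|s sx] := @mean_value _ (fun t => a (t, y)) (fun t => a1 (t, y)) z.1 x.
  move=> sx.
  suff [] : [/\ is_derive s 1 (fun t => a (t, y)) (a1 (s, y)),
        is_derive y 1 (fun t => a (s, t)) (a2 (s, y)),
        `|a1 z - a1 (s, y)| <= e / 2 & `|a2 z - a2 (s, y)| <= e / 2] by [].
  apply: (B (s, y)); split => //=; rewrite /ball/=.
  by rewrite distrC (le_lt_trans sx)// distrC.
have [t|t tx] := @mean_value _ (fun t => a (z.1, t)) (fun t => a2 (z.1, t)) z.2 y.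
  move=> tx.
  suff [] : [/\ is_derive z.1 1 (fun s => a (s, t)) (a1 (z.1, t)),
        is_derive t 1 (fun t => a (z.1, t)) (a2 (z.1, t)),
        `|a1 z - a1 (z.1, t)| <= e / 2 & `|a2 z - a2 (z.1, t)| <= e / 2] by [].
  apply: (B (z.1, t)); split => //=; rewrite /ball/= ?subrr ?normr0//.
  by rewrite distrC (le_lt_trans tx)// distrC.
move=> E2 E1.
have [_ _ b1 _] : [/\ is_derive s 1 (fun t => a (t, y)) (a1 (s, y)),
        is_derive y 1 (fun t => a (s, t)) (a2 (s, y)),
        `|a1 z - a1 (s, y)| <= e / 2 & `|a2 z - a2 (s, y)| <= e / 2].
  apply: (B (s, y)); split => //=; rewrite /ball/=.
  by rewrite distrC (le_lt_trans sx)// distrC.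
have [_ _ _ b2] : [/\ is_derive z.1 1 (fun s => a (s, t)) (a1 (z.1, t)),
        is_derive t 1 (fun t => a (z.1, t)) (a2 (z.1, t)),
        `|a1 z - a1 (z.1, t)| <= e / 2 & `|a2 z - a2 (z.1, t)| <= e / 2].
  apply: (B (z.1, t)); split => //=; rewrite /ball/= ?subrr ?normr0//.
  by rewrite distrC (le_lt_trans tx)// distrC.
have -> : a (x, y) - a z - ((x - z.1) * a1 z + (y - z.2) * a2 z) =
  - ((a1 z - a1 (s, y)) * (x - z.1) + (a2 z - a2 (z.1, t)) * (y - z.2)).
  have -> : a (x, y) - a z = (a (x, y) - a (z.1, y)) + (a (z.1, y) - a (z.1, z.2)).
    by rewrite -z12; ring.
  by rewrite E1 E2; ring.
rewrite normrN (le_trans (ler_normD _ _))// !normrM.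
have n1 : `|x - z.1| <= `|(x, y) - z| by rewrite [leRHS]/Num.Def.normr/= le_max lexx.
have n2 : `|y - z.2| <= `|(x, y) - z| by rewrite [leRHS]/Num.Def.normr/= le_max lexx orbT.
rewrite [e]splitr mulrDl lerD// ler_pM//.
Unshelve. all: by end_near. Qed.

Lemma partials_differentiable :
  differentiable a z /\ forall w : R * R, 'd a z w = w.1 * a1 z + w.2 * a2 z.
Proof.
pose d (h : R * R) : R := h.1 * a1 z + h.2 * a2 z.
have dlin : linear d.
  move=> k [u1 u2] [v1 v2]; rewrite /d /=.
  by rewrite -![_ *: _]/(_ * _); ring.
pose dM := GRing.isLinear.Build _ _ _ _ _ dlin.
pose dL : {linear _ -> _} := HB.pack d dM.
have dc : continuous dL.
  move=> w; rewrite /continuous_at /=/d; apply: cvgD; apply: cvgMl.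
    exact: cvg_fst.
  exact: cvg_snd.
have da : (a \o shift z : R * R -> R) = (cst (a z) : R * R -> R) + (dL : R * R -> R) +o_ (0 : R * R) id.
  apply/eqaddoP => e e0.
  have sz : (fun h => h + z) @ (0 : R * R) --> z.
    by rewrite -[X in _ --> X]add0r; apply: cvgD; [exact: cvg_id|exact: cvg_cst].
  have := sz _ (partials_increment e0); rewrite /= => H.
  near=> h; have : `|a (h + z) - a z - (((h + z).1 - z.1) * a1 z +
      ((h + z).2 - z.2) * a2 z)| <= e * `|h + z - z|.
    by near: h.
  have -> : h + z - z = h by exact: addrK.
  have -> : (h + z).1 - z.1 = h.1 by exact: addrK.
  have -> : (h + z).2 - z.2 = h.2 by exact: addrK.
  by rewrite -addrA -opprD.
have e : 'd a z = dL :> (_ -> _) by exact: diff_unique.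
split; last by move=> w; rewrite e.
by apply/diff_locallyP; rewrite e.
Unshelve. all: by end_near. Qed.

Lemma is_derive_curve (x y : R -> R) (t dx dy : R) : (x t, y t) = z ->
  is_derive t 1 x dx -> is_derive t 1 y dy ->
  is_derive t 1 (fun s => a (x s, y s)) (dx * a1 z + dy * a2 z).
Proof.
move=> e [/derivable1_diffP xd xv] [/derivable1_diffP yd yv].
have [da dE] := partials_differentiable.
have pd : differentiable (fun s => (x s, y s)) t by exact: differentiable_pair.
have ad : differentiable (a \o (fun s => (x s, y s))) t.
  by apply: differentiable_comp => //=; rewrite e.
apply: DeriveDef; first exact/derivable1_diffP.
have da' : differentiable a ((fun s => (x s, y s)) t) by rewrite /= e.
have -> : 'D_1 (fun s => a (x s, y s)) t = 'd (a \o (fun s => (x s, y s))) t 1.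
  exact: deriveE ad.
rewrite (diff_comp pd da') /= (diff_pair xd yd) /= e dE /=.
by rewrite -(deriveE _ xd) -(deriveE _ yd) xv yv.
Qed.

End C1Chain.

(** * Integrals depending on a parameter *)

Section ParametricIntegral.
Context {R : realType}.
Variables (a b : R).
Hypothesis ab : a < b.
Local Notation mu := (@lebesgue_measure R).
Implicit Types (f F : R -> R).

Lemma continuous_integrable f : continuous f -> mu.-integrable `[a, b] (EFin \o f).
Proof.
move=> fc; apply: continuous_compact_integrable; first exact: segment_compact.
exact: continuous_subspaceT.
Qed.

Lemma Rintegral_itv_cst (c : R) : (\int[mu]_(t in `[a, b]) c = c * (b - a))%R.
Proof.
rewrite Rintegral_cst//= lebesgue_measure_itv/= lte_fin ab/=.
by rewrite mulrC.
Qed.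

Lemma Rintegral_bound f (M : R) : continuous f ->
  (forall t, t \in `[a, b] -> `|f t| <= M) ->
  `|\int[mu]_(t in `[a, b]) f t|%R <= M * (b - a).
Proof.
move=> fc fM; rewrite (le_trans (le_normr_Rintegral _ (continuous_integrable fc)))//.
rewrite -Rintegral_itv_cst; apply: le_Rintegral => //.
- by apply: (@continuous_integrable (fun t => `|f t|)) => t; apply: cvg_norm; exact: fc.
- by apply: continuous_integrable => t; exact: cvg_cst.
Qed.

Lemma Rintegral_FTC f F : continuous f -> (forall t : R, is_derive t 1 F (f t)) ->
  (\int[mu]_(t in `[a, b]) f t = F b - F a)%R.
Proof.
move=> fc Ff; rewrite /Rintegral (@continuous_FTC2 _ f F)//.
- exact: continuous_subspaceT.
- have Fc t : {for t, continuous F}.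
    exact/differentiable_continuous/derivable1_diffP.
  split; first by [].
  - exact/cvg_at_right_filter/Fc.
  - exact/cvg_at_left_filter/Fc.
- by move=> t _; rewrite derive1E derive_val.
Qed.

(** Compactness of the segment makes the joint continuity uniform in [t]: this is the tube lemma, in
    the form of [compact_near_coveringP]. *)
Lemma Rintegral_continuous (T : topologicalType) (g : T -> R -> R) (p0 : T) :
  (\forall p \near p0, continuous (g p)) ->
  (forall t, t \in `[a, b] -> {for (p0, t), continuous (fun q => g q.1 q.2)}) ->
  (fun p => \int[mu]_(t in `[a, b]) g p t)%R @ p0 -->
  (\int[mu]_(t in `[a, b]) g p0 t)%R.
Proof.
move=> gc gj; apply/cvgrPdist_le => e e0.
have d0 : 0 < e / (b - a) by rewrite divr_gt0// subr_gt0.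
have := @segment_compact _ a b; rewrite compact_near_coveringP => K.
have H : \forall p \near p0, `[a, b] `<=` (fun t => `|g p0 t - g p t| <= e / (b - a)).
  apply: K => t tab.
  have d20 : 0 < e / (b - a) / 2 by rewrite divr_gt0.
  have := gj t tab; move=> /cvgrPdist_le/(_ _ d20)[[/= A B] [/= Ap Bt] AB].
  have Ap0 := nbhs_singleton Ap.
  exists (B, A) => //= -[t' p] [/= Bt' Ap'].
  have h1 := AB (p0, t') (conj Ap0 Bt'); have h2 := AB (p, t') (conj Ap' Bt').
  rewrite /= in h1 h2; rewrite -(subrKA (g p0 t)) [_ / (b - a)]splitr.
  by rewrite (le_trans (ler_normD _ _))// lerD// distrC.
have gp0 := nbhs_singleton gc.
near=> p.
have gpc : continuous (g p) by near: p.
rewrite -RintegralB//; [|exact: continuous_integrable..].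
have -> : e = e / (b - a) * (b - a) by rewrite divfK// subr_eq0 gt_eqF.
apply: Rintegral_bound => [t|t tab].
  by apply: cvgB; [exact: gp0|exact: gpc].
by move: t tab; near: p.
Unshelve. all: by end_near. Qed.

Lemma is_derive_Rintegral_dominated (g dg : R -> R -> R) (t0 r M : R) : 0 < r ->
  (forall t, `|t - t0| < r -> continuous (g t)) ->
  (forall t s : R, `|t - t0| < r -> is_derive t 1 (g ^~ s) (dg t s)) ->
  (forall t s : R, `|t - t0| < r -> s \in `[a, b] -> `|dg t s| <= M) ->
  is_derive t0 1 (fun t => \int[mu]_(s in `[a, b]) g t s)%R
    (\int[mu]_(s in `[a, b]) dg t0 s)%R.
Proof.
move=> r0 gc gd gM.
have I0 : `]t0 - r, t0 + r[%classic t0 by rewrite /= in_itv /=; lra.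
have Ir t : `]t0 - r, t0 + r[%classic t -> `|t - t0| < r.
  by rewrite /= in_itv /= ltr_norml; lra.
have gi t : `]t0 - r, t0 + r[%classic t -> mu.-integrable `[a, b] (EFin \o g t).
  by move=> /Ir/gc; exact: continuous_integrable.
have gd' t s : `]t0 - r, t0 + r[%classic t -> `[a, b]%classic s -> derivable (g ^~ s) t 1.
  by move=> /Ir/(gd _ s) [].
have M0 : 0 <= M.
  apply: le_trans (gM t0 a _ _); rewrite ?subrr ?normr0//.
  by rewrite in_itv/= lexx ltW.
have gM' t s : `]t0 - r, t0 + r[%classic t -> `[a, b]%classic s ->
    `|partial1of2 g t s| <= cst M s.
  by move=> /Ir tr sab; rewrite partial1of2E; have [_ ->] := gd t s tr; exact: gM.
have Mi : mu.-integrable `[a, b] (EFin \o cst M).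
  by apply: (@continuous_integrable (cst M)) => t; exact: cvg_cst.
have mab : measurable (`[a, b]%classic : set (measurableTypeR R)) by [].
have G0 : forall y : R, 0 <= cst M y by [].
apply: DeriveDef.
  exact: (@derivable_under_integral R _ _ mu g `[a, b]%classic mab t0 _ _ I0 gi
    gd' _ G0 Mi gM').
rewrite -derive1E.
rewrite (@differentiation_under_integral R _ _ mu g `[a, b]%classic mab t0 _ _ I0
  gi gd' _ G0 Mi gM').
by apply: eq_Rintegral => s _; rewrite partial1of2E; have [_ ->] := gd t0 s (Ir _ I0).
Qed.

(** Joint continuity bounds [dg] on a compact rectangle around [t0], and that bound is the
    dominating constant. *)
Lemma is_derive_Rintegral (g dg : R -> R -> R) (t0 r : R) : 0 < r ->
  (forall t, `|t - t0| < r -> continuous (g t)) ->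
  (forall t s : R, `|t - t0| < r -> is_derive t 1 (g ^~ s) (dg t s)) ->
  (forall t s : R, `|t - t0| < r ->
     {for (t, s), continuous (fun q : R * R => dg q.1 q.2)}) ->
  is_derive t0 1 (fun t => \int[mu]_(s in `[a, b]) g t s)%R
    (\int[mu]_(s in `[a, b]) dg t0 s)%R.
Proof.
move=> r0 gc gd gj; have r20 : 0 < r / 2 by rewrite divr_gt0.
pose K := `[t0 - r / 2, t0 + r / 2]%classic `*` `[a, b]%classic.
have Kc : compact K by apply: compact_setX; exact: segment_compact.
have gK : {within K, continuous (fun q : R * R => dg q.1 q.2)}.
  apply: continuous_in_subspaceT => -[t s]; rewrite inE/= => -[/= + _].
  rewrite in_itv/= => tr; apply: gj.
  by rewrite ltr_norml; lra.
have /compact_bounded[M0 [_ HM]] := continuous_compact gK Kc.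
apply: (@is_derive_Rintegral_dominated g dg t0 (r / 2) (M0 + 1)) => //.
- by move=> t tr; apply: gc; lra.
- by move=> t s tr; apply: gd; lra.
- move=> t s tr sab; apply: (HM (M0 + 1)); first by rewrite ltrDl.
  exists (t, s) => //; split => //=.
  by move: tr; rewrite in_itv/= ltr_norml; lra.
Qed.

End ParametricIntegral.

(** * Cauchy-Riemann pairs *)

Section CauchyRiemann.
Context {R : realType}.
Implicit Types (U : set (R * R)) (a b c d phi psi : R * R -> R) (z p : R * R).

Lemma ball_pairP z r p : ball z r p <-> `|z.1 - p.1| < r /\ `|z.2 - p.2| < r.
Proof. by []. Qed.

Lemma continuous_pair_fun (T : topologicalType) (q : T) (X Y : T -> R) :
  {for q, continuous X} -> {for q, continuous Y} ->
  {for q, continuous (fun t => (X t, Y t))}.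
Proof. by move=> Xc Yc; exact: cvg_pair Xc Yc. Qed.

Lemma cvg_pair_fun (T : topologicalType) (q : T) phi (X Y : T -> R) :
  {for (X q, Y q), continuous phi} ->
  {for q, continuous X} -> {for q, continuous Y} ->
  {for q, continuous (fun t => phi (X t, Y t))}.
Proof.
move=> pc Xc Yc; apply: (@cvg_comp _ _ _ (fun t => (X t, Y t)) phi) pc.
exact: cvg_pair Xc Yc.
Qed.

(* With [h = a + i b], the complex derivative of [h] is [c + i d].            *)
Definition cauchy_riemann U a b c d := forall p, U p ->
  [/\ is_derive p.1 (1 : R) (fun t => a (t, p.2)) (c p),
      is_derive p.2 (1 : R) (fun t => a (p.1, t)) (- d p),
      is_derive p.1 (1 : R) (fun t => b (t, p.2)) (d p) &
      is_derive p.2 (1 : R) (fun t => b (p.1, t)) (c p)] /\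
  {for p, continuous c} /\ {for p, continuous d}.

(** Multiplication of [h] by [- i]. It transfers to [d] whatever is proved for the real part [c] of
    the derivative. *)
Lemma cauchy_riemann_rot U a b c d : cauchy_riemann U a b c d ->
  cauchy_riemann U b (fun p => - a p) d (fun p => - c p).
Proof.
move=> H p /H[[a1 a2 b1 b2] [cc dc]]; split; last first.
  by split => //; exact: cvgN.
split => //.
- by rewrite opprK.
- exact: is_derive_opp.
- by rewrite -[d p]opprK; exact: is_derive_opp.
Qed.

Definition circle_pt z (r s : R) : R * R := (z.1 + r * cos s, z.2 + r * sin s).

Lemma normr_cos_le1 (s : R) : `|cos s| <= 1.
Proof. by rewrite ler_norml cos_geN1 cos_le1. Qed.

Lemma normr_sin_le1 (s : R) : `|sin s| <= 1.
Proof. by rewrite ler_norml sin_geN1 sin_le1. Qed.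

Lemma ball_circle_pt z (r e s : R) : `|r| < e -> ball z e (circle_pt z r s).
Proof.
move=> re; apply/ball_pairP; rewrite /= !opprD !addrA !subrr !add0r !normrN !normrM.
by split; apply: le_lt_trans re; rewrite ler_piMr// ?normr_cos_le1 ?normr_sin_le1.
Qed.

Lemma is_derive_translate (V : normedModType R) (g : R -> V) (x h : R) dg :
  is_derive (x + h) (1 : R) g dg -> is_derive x (1 : R) (fun t => g (t + h)) dg.
Proof.
move=> H.
have K : is_derive x (1 : R) (fun t => t + h) (1 + 0).
  exact: (is_derive_add (is_derive_id _ _) (is_derive_const _ _ _)).
rewrite addr0 in K.
by have := @is_derive_comp_real _ _ _ g (fun t => t + h) x 1 1 dg H K; rewrite scale1r.
Qed.

End CauchyRiemann.

Section CauchyIntegral.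
Context {R : realType}.
Variables (U : set (R * R)) (a b c d : R * R -> R).
Hypothesis Uo : open U.
Hypothesis CR : cauchy_riemann U a b c d.
Local Notation mu := (@lebesgue_measure R).
Local Notation circle_int f := (\int[mu]_(s in `[0, 2 * pi]) (f : R -> R) s)%R.

Lemma cauchy_riemann_near (P : R * R -> Prop) p : U p -> (forall q, U q -> P q) ->
  \forall q \near p, P q.
Proof. by move=> Up H; apply: filterS H _; exact: open_nbhs_nbhs. Qed.

Lemma cauchy_riemann_curve (x y : R -> R) (t dx dy : R) : U (x t, y t) ->
  is_derive t 1 x dx -> is_derive t 1 y dy ->
  is_derive t 1 (fun s => a (x s, y s)) (dx * c (x t, y t) - dy * d (x t, y t)) /\
  is_derive t 1 (fun s => b (x s, y s)) (dx * d (x t, y t) + dy * c (x t, y t)).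
Proof.
move=> Up hx hy; have [_ [cc dc]] := CR Up; split.
  rewrite -mulrN; apply: (@is_derive_curve _ a c (fun p => - d p)) => //.
  - by apply: cauchy_riemann_near Up _ => q /CR[[]].
  - by apply: cauchy_riemann_near Up _ => q /CR[[]].
  - exact: cvgN.
apply: (@is_derive_curve _ b d c) => //.
- by apply: cauchy_riemann_near Up _ => q /CR[[]].
- by apply: cauchy_riemann_near Up _ => q /CR[[]].
Qed.

Lemma cauchy_riemann_continuous p : U p ->
  {for p, continuous a} /\ {for p, continuous b}.
Proof.
move=> Up; have [_ [cc dc]] := CR Up; split; apply: differentiable_continuous.
  suff [] : differentiable a p /\ forall w : R * R, 'd a p w = w.1 * c p + w.2 * - d p by [].
  apply: (@partials_differentiable _ a c (fun p => - d p)) => //.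
  - by apply: cauchy_riemann_near Up _ => q /CR[[]].
  - by apply: cauchy_riemann_near Up _ => q /CR[[]].
  - exact: cvgN.
suff [] : differentiable b p /\ forall w : R * R, 'd b p w = w.1 * d p + w.2 * c p by [].
apply: (@partials_differentiable _ b d c) => //.
- by apply: cauchy_riemann_near Up _ => q /CR[[]].
- by apply: cauchy_riemann_near Up _ => q /CR[[]].
Qed.

End CauchyIntegral.

(** * Cauchy's formula for the derivative *)

Section CircleIntegral.
Context {R : realType}.
Implicit Types (U : set (R * R)) (a b c d phi psi : R * R -> R) (z p : R * R).
Local Notation mu := (@lebesgue_measure R).

Lemma two_pi_gt0 : 0 < 2 * pi :> R. Proof. by rewrite mulr_gt0 ?pi_gt0. Qed.

(* The real part of [\int h(z + r e^(is)) e^(-is) ds] over [0, 2 pi] for      *)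
(* [h = phi + i psi].                                                         *)
Definition circle_int phi psi (r : R) z : R :=
  (\int[mu]_(s in `[0, (2 * pi)%R])
     (phi (circle_pt z r s) * cos s + psi (circle_pt z r s) * sin s))%R.

Lemma is_derive_affine (p m t : R) : is_derive t (1 : R) (fun t => p + t * m) m.
Proof. by apply: is_derive_eq; rewrite /GRing.scale /=; ring. Qed.

Lemma is_derive_lincomb (f g : R -> R) (t p q df dg : R) :
  is_derive t (1 : R) f df -> is_derive t (1 : R) g dg ->
  is_derive t (1 : R) (fun t => f t * p + g t * q) (df * p + dg * q).
Proof.
move=> hf hg.
have := is_derive_add (is_derive_scalec p hf) (is_derive_scalec q hg).
rewrite -![_ *: _]/(_ * _) ![_ * df]mulrC ![_ * dg]mulrC.
by under eq_fun do rewrite -![_ *: _]/(_ * _) ![_ * f _]mulrC ![_ * g _]mulrC.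
Qed.

Lemma continuous_circle_pt (T : topologicalType) (q : T) phi
    (Z : T -> R * R) (r s : T -> R) :
  {for circle_pt (Z q) (r q) (s q), continuous phi} ->
  {for q, continuous Z} -> {for q, continuous r} -> {for q, continuous s} ->
  {for q, continuous (fun t => phi (circle_pt (Z t) (r t) (s t)))}.
Proof.
move=> pc Zc rc sc; apply: cvg_pair_fun => //.
  apply: cvgD; first exact: (cvg_comp _ _ Zc cvg_fst).
  by apply: cvgM => //; apply: (cvg_comp _ _ sc); exact: continuous_cos.
apply: cvgD; first exact: (cvg_comp _ _ Zc cvg_snd).
by apply: cvgM => //; apply: (cvg_comp _ _ sc); exact: continuous_sin.
Qed.

Section Formula.
Variables (U : set (R * R)) (a b c d : R * R -> R).
Hypothesis Uo : open U.
Hypothesis CR : cauchy_riemann U a b c d.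
Variables (z : R * R) (rho : R).
Hypothesis zU : ball z rho `<=` U.

Let circU (t s : R) : `|t| < rho -> U (circle_pt z t s).
Proof. by move=> tr; apply: zU; exact: ball_circle_pt. Qed.

Let cont (t s : R) : `|t| < rho ->
  let P phi := {for (t, s), continuous (fun q : R * R => phi (circle_pt z q.1 q.2))} in
  [/\ P a, P b, P c & P d].
Proof.
move=> tr /=; have Up := circU s tr.
have [ac bc] := cauchy_riemann_continuous Uo CR Up; have [_ [cc dc]] := CR Up.
suff H phi : {for circle_pt z t s, continuous phi} ->
    {for (t, s), continuous (fun q : R * R => phi (circle_pt z q.1 q.2))}.
  by split; exact: H.
move=> pc; apply: (@continuous_circle_pt _ (t, s) phi (fun=> z) fst snd pc).
- exact: cvg_cst.
- exact: cvg_fst.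
- exact: cvg_snd.
Qed.

Let conts (t s : R) : `|t| < rho ->
  let P phi := {for s, continuous (fun s => phi (circle_pt z t s))} in
  [/\ P a, P b, P c & P d].
Proof.
move=> tr /=; have Up := circU s tr.
have [ac bc] := cauchy_riemann_continuous Uo CR Up; have [_ [cc dc]] := CR Up.
suff H phi : {for circle_pt z t s, continuous phi} ->
    {for s, continuous (fun s => phi (circle_pt z t s))}.
  by split; exact: H.
move=> pc; apply: (@continuous_circle_pt _ s phi (fun=> z) (fun=> t) id pc).
- exact: cvg_cst.
- exact: cvg_cst.
- exact: cvg_id.
Qed.

Let N (t : R) := (\int[mu]_(s in `[0, (2 * pi)%R]) c (circle_pt z t s))%R.

(** Along a radius the derivative of [h] is [e^(is) h'], and the kernel [e^(-is)] cancels the first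
    factor. *)
Let circle_int_radial (t : R) : `|t| < rho ->
  is_derive t (1 : R) (fun t => circle_int a b t z) (N t).
Proof.
move=> tr; have r0 : 0 < rho - `|t| by rewrite subr_gt0.
have tr' (u : R) : `|u - t| < rho - `|t| -> `|u| < rho.
  move=> H; rewrite -(subrK t u) (le_lt_trans (ler_normD _ _))//.
  by rewrite -ltrBrDr.
apply: (@is_derive_Rintegral _ _ _ two_pi_gt0 (fun t s =>
    a (circle_pt z t s) * cos s + b (circle_pt z t s) * sin s)
    (fun t s => c (circle_pt z t s)) t _ r0).
- move=> u /tr' ur s; have [ac bc _ _] := conts s ur.
  by apply: cvgD; apply: cvgM => //; [exact: continuous_cos|exact: continuous_sin].
- move=> u s /tr' ur.
  have Hx : is_derive u (1 : R) (fun u => z.1 + u * cos s) (cos s).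
    exact: is_derive_affine.
  have Hy : is_derive u (1 : R) (fun u => z.2 + u * sin s) (sin s).
    exact: is_derive_affine.
  have [Ha Hb] := @cauchy_riemann_curve _ U a b c d Uo CR
    (fun u => z.1 + u * cos s) (fun u => z.2 + u * sin s) u _ _ (circU s ur) Hx Hy.
  apply: is_derive_eq (is_derive_lincomb (cos s) (sin s) Ha Hb) _.
  transitivity (c (circle_pt z u s) * (cos s ^+ 2 + sin s ^+ 2)).
    by rewrite /circle_pt; ring.
  by rewrite cos2Dsin2 mulr1.
- by move=> u s /tr' ur; have [] := cont s ur.
Qed.

(** The imaginary part of [h e^(-is)] is periodic in [s], and its [s]-derivative is the real part of
    [t h' - h e^(-is)], whose integral over a period therefore vanishes. *)
Let circle_int_by_parts (t : R) : `|t| < rho -> circle_int a b t z = t * N t.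
Proof.
move=> tr; have H (s : R) : is_derive s (1 : R)
    (fun s => b (circle_pt z t s) * cos s - a (circle_pt z t s) * sin s)
    (t * c (circle_pt z t s) -
      (a (circle_pt z t s) * cos s + b (circle_pt z t s) * sin s)).
  have Hx : is_derive s (1 : R) (fun s => z.1 + t * cos s) (- (t * sin s)).
    by apply: is_derive_eq; rewrite /GRing.scale /=; ring.
  have Hy : is_derive s (1 : R) (fun s => z.2 + t * sin s) (t * cos s).
    by apply: is_derive_eq; rewrite /GRing.scale /=; ring.
  have [Ha Hb] := @cauchy_riemann_curve _ U a b c d Uo CR
    (fun s => z.1 + t * cos s) (fun s => z.2 + t * sin s) s _ _ (circU s tr) Hx Hy.
  have Hc := @is_deriveB _ _ _ _ _ _ _ _ _
    (is_deriveM Hb (is_derive_cos s)) (is_deriveM Ha (is_derive_sin s)).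
  apply: is_derive_eq Hc _.
  rewrite -[circle_pt z t s]/(z.1 + t * cos s, z.2 + t * sin s).
  set cc := c _; set dd := d _; set aa := a _; set bb := b _.
  rewrite /GRing.scale /=.
  transitivity (t * cc * (cos s ^+ 2 + sin s ^+ 2) - (aa * cos s + bb * sin s)).
    by ring.
  by rewrite cos2Dsin2 mulr1.
have cc : continuous (fun s => c (circle_pt z t s)).
  by move=> s; have [] := conts s tr.
have abc : continuous (fun s =>
    a (circle_pt z t s) * cos s + b (circle_pt z t s) * sin s).
  move=> s; have [ac bc _ _] := conts s tr.
  by apply: cvgD; apply: cvgM => //; [exact: continuous_cos|exact: continuous_sin].
have tcc : continuous (fun s => t * c (circle_pt z t s)).
  by move=> s; apply: cvgM; [exact: cvg_cst|exact: cc].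
have ic : continuous (fun s => t * c (circle_pt z t s) -
      (a (circle_pt z t s) * cos s + b (circle_pt z t s) * sin s)).
  by move=> s; apply: cvgB; [exact: tcc|exact: abc].
have := Rintegral_FTC two_pi_gt0 ic H.
rewrite [X in _ = X](_ : _ = 0); last first.
  by rewrite /circle_pt mulr_natl cos2pi sin2pi cos0 sin0 subrr.
rewrite RintegralB//; [|exact: continuous_integrable..].
rewrite RintegralZl//; last exact: continuous_integrable.
by move=> /eqP; rewrite subr_eq0 => /eqP/esym.
Qed.

(** Write [F] for the circle integral as a function of the radius. The two preceding facts read
    [F' = N] and [F = t N], so [N = F / t] has derivative zero for [t > 0]; it is constant, and its
    limit at [0] is [2 pi c(z)]. *)
Lemma circle_int_mean (t : R) : 0 < t < rho ->
  circle_int a b t z = 2 * pi * t * c z.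
Proof.
move=> /andP[t0 tr].
have trN : `|t| < rho by rewrite gtr0_norm.
have Nt s : 0 < s <= t -> N s = N t.
  move=> /andP[s0 st].
  have quot u : 0 < u -> `|u| < rho -> N u = circle_int a b u z / u.
    by move=> u0 ur; rewrite circle_int_by_parts// mulrC mulKf// gt_eqF.
  rewrite quot ?gtr0_norm ?(le_lt_trans st)// quot ?gtr0_norm//.
  apply/esym.
  apply: (@constant_of_derive0_itv _ (fun u => circle_int a b u z / u)) => // u.
  move=> /andP[su ut].
  have u0 : 0 < u by exact: lt_le_trans su.
  have ur : `|u| < rho by rewrite gtr0_norm// (le_lt_trans ut).
  have Hi := @is_deriveV _ id u 1 1 (lt0r_neq0 u0) (is_derive_id _ _).
  have H := is_deriveM (circle_int_radial ur) Hi.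
  apply: is_derive_eq H _.
  rewrite circle_int_by_parts// /GRing.scale /= mulr1.
  by field; rewrite gt_eqF.
have N0 : N 0 = 2 * pi * c z.
  rewrite /N; under eq_Rintegral do rewrite /circle_pt !mul0r !addr0 -surjective_pairing.
  by rewrite (Rintegral_itv_cst two_pi_gt0) subr0 mulrC.
have Nc : N s @[s --> (0 : R)^'+] --> N 0.
  apply: cvg_at_right_filter.
  have rho0 : 0 < rho by exact: lt_trans tr.
  apply: (@Rintegral_continuous _ _ _ two_pi_gt0 _ (fun t s => c (circle_pt z t s))).
    have nb : \forall u \near (0 : R), `|u| < rho.
      by exists rho => //= u; rewrite /ball_/= sub0r normrN.
    by apply: filterS nb => u ur s; have [] := conts s ur.
  by move=> s _; have [] := @cont 0 s; rewrite ?normr0.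
have NN : N s @[s --> (0 : R)^'+] --> N t.
  apply: cvg_near_cst; near=> s; apply: Nt; apply/andP; split.
    by near: s; exact: nbhs_right_gt.
  by near: s; exact: nbhs_right_le.
have : N t = N 0 by apply: cvg_unique NN Nc.
rewrite circle_int_by_parts// => ->; rewrite N0; ring.
Unshelve. all: by end_near. Qed.

End Formula.
End CircleIntegral.

(** * Existence of all derivatives *)

Section Smoothness.
Context {R : realType}.
Implicit Types (a b c d phi psi : R * R -> R) (z p : R * R).
Variable U : set (R * R).
Hypothesis Uo : open U.

Lemma ball_circle_pt_shift z p (r t s : R) :
  0 <= t -> ball z r p -> ball z (r + t) (circle_pt p t s).
Proof.
move=> t0 /ball_pairP[h1 h2]; apply/ball_pairP; rewrite /= !opprD !addrA.
by split; apply: le_lt_trans (ler_normB _ _) _; apply: ltr_leD => //;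
  rewrite normrM ger0_norm// ler_piMr// ?normr_cos_le1 ?normr_sin_le1.
Qed.

Lemma near_ball_line_x z p (r : R) : ball z r p ->
  \forall t \near p.1, ball z r (t, p.2).
Proof.
move=> /ball_pairP[h1 h2]; exists (r - `|z.1 - p.1|) => /=; first by rewrite subr_gt0.
move=> t; rewrite /ball_/= => tp; apply/ball_pairP; split => //=.
rewrite -(subrKA p.1) (le_lt_trans (ler_normD _ _))//.
by rewrite addrC -ltrBrDr.
Qed.

Lemma near_ball_line_y z p (r : R) : ball z r p ->
  \forall t \near p.2, ball z r (p.1, t).
Proof.
move=> /ball_pairP[h1 h2]; exists (r - `|z.2 - p.2|) => /=; first by rewrite subr_gt0.
move=> t; rewrite /ball_/= => tp; apply/ball_pairP; split => //=.
rewrite -(subrKA p.2) (le_lt_trans (ler_normD _ _))//.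
by rewrite addrC -ltrBrDr.
Qed.

Let cont_on phi := forall p, U p -> {for p, continuous phi}.

Lemma continuous_circle_weight phi psi z (r : R) :
  (forall s, U (circle_pt z r s)) -> cont_on phi -> cont_on psi ->
  continuous (fun s => phi (circle_pt z r s) * cos s + psi (circle_pt z r s) * sin s).
Proof.
move=> zU pc sc s.
apply: cvgD; apply: cvgM; [|exact: continuous_cos| |exact: continuous_sin].
  apply: (@continuous_circle_pt _ _ s phi (fun=> z) (fun=> r) id) => //.
  - exact: pc.
  - exact: cvg_cst.
  - exact: cvg_cst.
apply: (@continuous_circle_pt _ _ s psi (fun=> z) (fun=> r) id) => //.
- exact: sc.
- exact: cvg_cst.
- exact: cvg_cst.
Qed.

Lemma continuous_circle_weight_param (T : topologicalType) (Z : T -> R * R) t0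
    phi psi (r s0 : R) :
  U (circle_pt (Z t0) r s0) -> {for t0, continuous Z} -> cont_on phi -> cont_on psi ->
  {for (t0, s0), continuous (fun q : T * R =>
    phi (circle_pt (Z q.1) r q.2) * cos q.2 + psi (circle_pt (Z q.1) r q.2) * sin q.2)}.
Proof.
move=> zU Zc pc sc.
have c1 : {for (t0, s0), continuous (fun q : T * R => Z q.1)}.
  by apply: (@cvg_comp _ _ _ fst Z _ (nbhs t0)) Zc; exact: cvg_fst.
have c2 : {for (t0, s0), continuous (fun q : T * R => q.2)} by exact: cvg_snd.
apply: cvgD; apply: cvgM.
- apply: (@continuous_circle_pt _ _ (t0, s0) phi (fun q : T * R => Z q.1) (fun=> r) snd) => //.
    exact: pc.
  exact: cvg_cst.
- exact: (cvg_comp _ _ c2 (@continuous_cos _ s0)).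
- apply: (@continuous_circle_pt _ _ (t0, s0) psi (fun q : T * R => Z q.1) (fun=> r) snd) => //.
    exact: sc.
  exact: cvg_cst.
- exact: (cvg_comp _ _ c2 (@continuous_sin _ s0)).
Qed.

Lemma continuous_circle_int phi psi z (r : R) : 0 < r -> ball z (2 * r) `<=` U ->
  cont_on phi -> cont_on psi -> {for z, continuous (circle_int phi psi r)}.
Proof.
move=> r0 zU pc sc.
have near_U p s : ball z r p -> U (circle_pt p r s).
  move=> zp; apply: zU; have -> : 2 * r = r + r by ring.
  by apply: ball_circle_pt_shift => //; exact: ltW.
apply: (@Rintegral_continuous _ _ _ two_pi_gt0 _ (fun p s =>
  phi (circle_pt p r s) * cos s + psi (circle_pt p r s) * sin s)).
  near=> p; apply: continuous_circle_weight => // s; apply: near_U.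
  by near: p; exact: nbhsx_ballx.
move=> s _; apply: (@continuous_circle_weight_param (R * R)%type id z phi psi r s) => //.
by apply: near_U; exact: ballxx.
Unshelve. all: by end_near. Qed.

Lemma is_derive_circle_int_x phi psi phi1 psi1 z (r : R) : 0 < r ->
  ball z (2 * r) `<=` U ->
  cont_on phi -> cont_on psi -> cont_on phi1 -> cont_on psi1 ->
  (forall p, U p -> is_derive p.1 (1 : R) (fun t => phi (t, p.2)) (phi1 p)) ->
  (forall p, U p -> is_derive p.1 (1 : R) (fun t => psi (t, p.2)) (psi1 p)) ->
  is_derive z.1 (1 : R) (fun t => circle_int phi psi r (t, z.2))
    (circle_int phi1 psi1 r z).
Proof.
move=> r0 zU pc sc pc1 sc1 dp ds.
have near_U t s : `|t - z.1| < r -> U (circle_pt (t, z.2) r s).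
  move=> tz; apply: zU; have -> : 2 * r = r + r by ring.
  apply: ball_circle_pt_shift; first exact: ltW.
  by apply/ball_pairP; rewrite /= subrr normr0 distrC.
rewrite [X in is_derive _ _ _ (circle_int _ _ _ X)]surjective_pairing.
apply: (@is_derive_Rintegral _ _ _ two_pi_gt0 (fun t s =>
  phi (circle_pt (t, z.2) r s) * cos s + psi (circle_pt (t, z.2) r s) * sin s)
  (fun t s =>
  phi1 (circle_pt (t, z.2) r s) * cos s + psi1 (circle_pt (t, z.2) r s) * sin s) _ _ r0).
- by move=> t tz; apply: continuous_circle_weight => // s; exact: near_U.
- move=> t s tz; have Up := near_U t s tz.
  apply: is_derive_lincomb.
    exact: (@is_derive_translate _ _ (fun t => phi (t, z.2 + r * sin s)) t _ _ (dp _ Up)).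
  exact: (@is_derive_translate _ _ (fun t => psi (t, z.2 + r * sin s)) t _ _ (ds _ Up)).
- move=> t s tz.
  apply: (@continuous_circle_weight_param R (fun t => (t, z.2)) t phi1 psi1 r s) => //.
    exact: near_U.
  by apply: continuous_pair_fun; [exact: cvg_id|exact: cvg_cst].
Qed.

Lemma is_derive_circle_int_y phi psi phi1 psi1 z (r : R) : 0 < r ->
  ball z (2 * r) `<=` U ->
  cont_on phi -> cont_on psi -> cont_on phi1 -> cont_on psi1 ->
  (forall p, U p -> is_derive p.2 (1 : R) (fun t => phi (p.1, t)) (phi1 p)) ->
  (forall p, U p -> is_derive p.2 (1 : R) (fun t => psi (p.1, t)) (psi1 p)) ->
  is_derive z.2 (1 : R) (fun t => circle_int phi psi r (z.1, t))
    (circle_int phi1 psi1 r z).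
Proof.
move=> r0 zU pc sc pc1 sc1 dp ds.
have near_U t s : `|t - z.2| < r -> U (circle_pt (z.1, t) r s).
  move=> tz; apply: zU; have -> : 2 * r = r + r by ring.
  apply: ball_circle_pt_shift; first exact: ltW.
  by apply/ball_pairP; rewrite /= subrr normr0 distrC.
rewrite [X in is_derive _ _ _ (circle_int _ _ _ X)]surjective_pairing.
apply: (@is_derive_Rintegral _ _ _ two_pi_gt0 (fun t s =>
  phi (circle_pt (z.1, t) r s) * cos s + psi (circle_pt (z.1, t) r s) * sin s)
  (fun t s =>
  phi1 (circle_pt (z.1, t) r s) * cos s + psi1 (circle_pt (z.1, t) r s) * sin s) _ _ r0).
- by move=> t tz; apply: continuous_circle_weight => // s; exact: near_U.
- move=> t s tz; have Up := near_U t s tz.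
  apply: is_derive_lincomb.
    exact: (@is_derive_translate _ _ (fun t => phi (z.1 + r * cos s, t)) t _ _ (dp _ Up)).
  exact: (@is_derive_translate _ _ (fun t => psi (z.1 + r * cos s, t)) t _ _ (ds _ Up)).
- move=> t s tz.
  apply: (@continuous_circle_weight_param R (fun t => (z.1, t)) t phi1 psi1 r s) => //.
    exact: near_U.
  by apply: continuous_pair_fun; [exact: cvg_cst|exact: cvg_id].
Qed.

(** Near a point, [c] and [d] are circle integrals of [a] and [b] with a fixed radius.
    Differentiating them in the centre uses only the first derivatives of [a] and [b], and produces
    circle integrals of [c] and [d], which are again continuous. *)
Theorem cauchy_riemann_derivative a b c d : cauchy_riemann U a b c d ->
  exists e, exists f, cauchy_riemann U c d e f.
Proof.
move=> CR.
have ac : cont_on a by move=> p /(cauchy_riemann_continuous Uo CR)[].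
have bc : cont_on b by move=> p /(cauchy_riemann_continuous Uo CR)[].
have cc : cont_on c by move=> p /CR[_ []].
have dc : cont_on d by move=> p /CR[_ []].
have Nc phi : cont_on phi -> cont_on (fun p => - phi p).
  by move=> pc p Up; apply: cvgN; exact: pc.
pose e p := 'D_1 (fun t => c (t, p.2)) p.1.
pose f p := 'D_1 (fun t => d (t, p.2)) p.1.
exists e, f => z Uz.
(* The centres [p] range over the ball of radius [r], and around each a ball of radius [3 * r] must
   stay in [U] for the formula on the circle of radius [r]. *)
have [r r0 zR] : exists2 r : R, 0 < r & ball z (4 * r) `<=` U.
  have /nbhs_ballP[e0 /= e00 ze] := open_nbhs_nbhs (conj Uo Uz).
  by exists (e0 / 4); [rewrite divr_gt0|rewrite mulrC divfK].
pose k := (2 * pi * r)^-1.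
have sub p : ball z r p -> ball p (3 * r) `<=` U.
  move=> zp q pq; apply: zR; have -> : 4 * r = r + 3 * r by ring.
  exact: ball_triangle pq.
have Ec p : ball z r p -> c p = k * circle_int a b r p.
  move=> zp; rewrite (circle_int_mean Uo CR (sub p zp)) /k; last by lra.
  by rewrite mulKf// gt_eqF// mulr_gt0// two_pi_gt0.
have Ed p : ball z r p -> d p = k * circle_int b (fun p => - a p) r p.
  move=> zp; rewrite (circle_int_mean Uo (cauchy_riemann_rot CR) (sub p zp)) /k; last by lra.
  by rewrite mulKf// gt_eqF// mulr_gt0// two_pi_gt0.
have sub2 p : ball z r p -> ball p (2 * r) `<=` U.
  by move=> zp; apply: subset_trans (sub p zp); apply: le_ball; lra.
have cx p : ball z r p ->
    is_derive p.1 (1 : R) (fun t => c (t, p.2)) (k * circle_int c d r p).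
  move=> zp.
  suff H : is_derive p.1 (1 : R) (fun t => circle_int a b r (t, p.2))
      (circle_int c d r p).
    apply: near_eq_is_derive (is_derive_scalec k H).
    by apply: filterS (near_ball_line_x zp) => t /Ec ->.
  apply: (is_derive_circle_int_x r0 (sub2 p zp)) => //.
    by move=> q /CR[[]].
  by move=> q /CR[[]].
have dx p : ball z r p ->
    is_derive p.1 (1 : R) (fun t => d (t, p.2)) (k * circle_int d (fun p => - c p) r p).
  move=> zp.
  suff H : is_derive p.1 (1 : R) (fun t => circle_int b (fun p => - a p) r (t, p.2))
      (circle_int d (fun p => - c p) r p).
    apply: near_eq_is_derive (is_derive_scalec k H).
    by apply: filterS (near_ball_line_x zp) => t /Ed ->.
  apply: (is_derive_circle_int_x r0 (sub2 p zp)) => //.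
  - exact: Nc.
  - exact: Nc.
  - by move=> q /CR[[]].
  - by move=> q /(cauchy_riemann_rot CR)[[]].
have cy p : ball z r p ->
    is_derive p.2 (1 : R) (fun t => c (p.1, t)) (k * circle_int (fun p => - d p) c r p).
  move=> zp.
  suff H : is_derive p.2 (1 : R) (fun t => circle_int a b r (p.1, t))
      (circle_int (fun p => - d p) c r p).
    apply: near_eq_is_derive (is_derive_scalec k H).
    by apply: filterS (near_ball_line_y zp) => t /Ec ->.
  apply: (is_derive_circle_int_y r0 (sub2 p zp)) => //.
  - exact: Nc.
  - by move=> q /CR[[]].
  - by move=> q /CR[[]].
have dy p : ball z r p ->
    is_derive p.2 (1 : R) (fun t => d (p.1, t)) (k * circle_int c d r p).
  move=> zp.
  suff H : is_derive p.2 (1 : R) (fun t => circle_int b (fun p => - a p) r (p.1, t))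
      (circle_int c d r p).
    apply: near_eq_is_derive (is_derive_scalec k H).
    by apply: filterS (near_ball_line_y zp) => t /Ed ->.
  apply: (is_derive_circle_int_y r0 (sub2 p zp)) => //.
  - exact: Nc.
  - by move=> q /CR[[]].
  - by move=> q /(cauchy_riemann_rot CR)[[]]; rewrite opprK.
have ee p : ball z r p -> e p = k * circle_int c d r p.
  by move=> /cx[_ <-].
have fe p : ball z r p -> f p = k * circle_int d (fun p => - c p) r p.
  by move=> /dx[_ <-].
have zz : ball z r z by exact: ballxx.
split; [split|split].
- by rewrite ee//; exact: cx.
- rewrite fe//; apply: is_derive_eq (cy z zz) _.
  rewrite -[RHS]/(- (k * circle_int d (fun p => - c p) r z)) -mulrN; congr (_ * _).
  have cw : continuous (fun s =>
      d (circle_pt z r s) * cos s + - c (circle_pt z r s) * sin s).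
    apply: (@continuous_circle_weight d (fun p => - c p)) => //; last exact: Nc.
    by move=> s; apply: (sub2 z zz); apply: ball_circle_pt; rewrite gtr0_norm//; lra.
  rewrite /circle_int -mulN1r -RintegralZl//; last exact: continuous_integrable.
  by apply: eq_Rintegral => s _; ring.
- by rewrite fe//; exact: dx.
- by rewrite ee//; exact: dy.
- have nb : \forall p \near z, k * circle_int c d r p = e p.
    by near=> p; rewrite ee//; near: p; exact: nbhsx_ballx.
  rewrite /prop_for /continuous_at ee//; apply: cvg_trans (near_eq_cvg nb) _.
  by apply: cvgM; [exact: cvg_cst|apply: continuous_circle_int (sub2 z zz) _ _].
- have nb : \forall p \near z, k * circle_int d (fun p => - c p) r p = f p.
    by near=> p; rewrite fe//; near: p; exact: nbhsx_ballx.
  rewrite /prop_for /continuous_at fe//; apply: cvg_trans (near_eq_cvg nb) _.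
  apply: cvgM; [exact: cvg_cst|apply: continuous_circle_int (sub2 z zz) _ _] => //.
  exact: Nc.
Unshelve. all: by end_near. Qed.

End Smoothness.

(** * The identity theorem *)

Section IdentityTheorem.
Context {R : realType}.
Implicit Types (a b c d : R * R -> R) (z p : R * R) (A B : nat -> R * R -> R).
Variable U : set (R * R).
Hypothesis Uo : open U.

Lemma cauchy_estimate a b c d z (rho M r : R) : cauchy_riemann U a b c d ->
  ball z rho `<=` U -> 0 < r < rho ->
  (forall p, ball z rho p -> `|a p| <= M /\ `|b p| <= M) ->
  `|c z| <= 2 * M / r.
Proof.
move=> CR zU /andP[r0 rrho] abM.
have := circle_int_mean Uo CR zU (t := r); rewrite r0 rrho => /(_ isT) E.
have k0 : 0 < 2 * pi * r :> R by rewrite mulr_gt0// two_pi_gt0.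
rewrite -(ler_pM2l k0) -{1}(gtr0_norm k0) -normrM -E.
have -> : 2 * pi * r * (2 * M / r) = 2 * M * (2 * pi - 0).
  by field; rewrite gt_eqF.
have circ s : ball z rho (circle_pt z r s).
  by apply: ball_circle_pt; rewrite gtr0_norm.
apply: (Rintegral_bound two_pi_gt0).
  apply: (@continuous_circle_weight _ U) => [s|p|p].
  - exact/zU/circ.
  - by move=> /(cauchy_riemann_continuous Uo CR)[].
  - by move=> /(cauchy_riemann_continuous Uo CR)[].
move=> s _; have [aM bM] := abM _ (circ s).
rewrite (le_trans (ler_normD _ _))// !normrM mulr2n mulrDl mul1r.
have M0 : 0 <= M by exact: le_trans aM.
by apply: lerD; rewrite -[M]mulr1 ler_pM// ?normr_cos_le1 ?normr_sin_le1.
Qed.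

Definition cauchy_riemann_seq A B :=
  forall k, cauchy_riemann U (A k) (B k) (A k.+1) (B k.+1).

(** The radius shrinks from [2 * rho] to [rho] in [K] equal steps. Each step uses [cauchy_estimate]
    on a circle of half the step's width, which costs a factor [4 K / rho]. *)
Lemma cauchy_estimate_iter A B z (rho M : R) (K : nat) :
  cauchy_riemann_seq A B -> 0 < rho -> ball z (2 * rho) `<=` U -> (0 < K)%N ->
  (forall p, ball z (2 * rho) p -> `|A 0%N p| <= M /\ `|B 0%N p| <= M) ->
  forall p, ball z rho p ->
    `|A K p| <= M * (4 * K%:R / rho) ^+ K /\ `|B K p| <= M * (4 * K%:R / rho) ^+ K.
Proof.
move=> CR rho0 zU K0 ABM.
have K0' : 0 < K%:R :> R by rewrite ltr0n.
pose del := rho / K%:R; have del0 : 0 < del by rewrite divr_gt0.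
suff H j p : (j <= K)%N -> ball z (2 * rho - j%:R * del) p ->
    `|A j p| <= M * (4 * K%:R / rho) ^+ j /\ `|B j p| <= M * (4 * K%:R / rho) ^+ j.
  move=> p zp; apply: H => //; rewrite (_ : _ - _ = rho)//.
  by rewrite /del; field; rewrite gt_eqF.
elim: j p => [|j IH] p jK zp.
  by rewrite expr0 mulr1; apply: ABM; rewrite mul0r subr0 in zp.
have sub q : ball p del q -> ball z (2 * rho - j%:R * del) q.
  move=> pq.
  have -> : 2 * rho - j%:R * del = (2 * rho - j.+1%:R * del) + del.
    by rewrite -natr1; ring.
  exact: ball_triangle pq.
have subU : ball p del `<=` U.
  move=> q /sub zq; apply: zU; apply: le_ball zq.
  by rewrite lerBlDr lerDl mulr_ge0// ltW.
have d2 : 0 < del / 2 < del by apply/andP; split; lra.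
have bound q : ball p del q -> `|A j q| <= M * (4 * K%:R / rho) ^+ j /\
    `|B j q| <= M * (4 * K%:R / rho) ^+ j.
  by move=> /sub zq; apply: IH => //; exact: ltnW.
have e : M * (4 * K%:R / rho) ^+ j.+1 =
    2 * (M * (4 * K%:R / rho) ^+ j) / (del / 2).
  by rewrite exprSr /del; field; rewrite !gt_eqF.
rewrite e; split; first exact: (cauchy_estimate (CR j) subU d2 bound).
have CR' := cauchy_riemann_rot (CR j).
apply: (cauchy_estimate CR' subU d2) => q /bound[h1 h2].
by rewrite normrN.
Qed.

Lemma norm_le_of_derive_le (f df : R -> R) (C t : R) (j : nat) : 0 <= t ->
  f 0 = 0 -> (forall s, 0 <= s <= t -> is_derive s (1 : R) f (df s)) ->
  (forall s, 0 <= s <= t -> `|df s| <= C * s ^+ j) ->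
  `|f t| <= C * t ^+ j.+1 / j.+1%:R.
Proof.
move=> t0 f0 fd dfC.
suff H (g dg : R -> R) : g 0 = 0 -> (forall s, 0 <= s <= t -> is_derive s (1 : R) g (dg s)) ->
    (forall s, 0 <= s <= t -> dg s <= C * s ^+ j) -> g t <= C * t ^+ j.+1 / j.+1%:R.
  rewrite ler_norml; apply/andP; split.
    rewrite -[f t]opprK lerN2; apply: (H (fun s => - f s) (fun s => - df s)).
    - by rewrite f0 oppr0.
    - by move=> s /fd; exact: is_derive_opp.
    - by move=> s /dfC; rewrite ler_norml => /andP[]; lra.
  apply: (H f df) => // s /dfC; exact: le_trans (ler_norm _).
move=> g0 gd dgC.
pose psi s := C / j.+1%:R * s ^+ j.+1 - g s.
have psid (s : R) : 0 <= s <= t -> is_derive s (1 : R) psi (C * s ^+ j - dg s).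
  move=> /gd hg; have hX' : is_derive s (1 : R) (fun s => s ^+ j.+1) (j.+1%:R * s ^+ j).
    by apply: DeriveDef; [exact: exprn_derivable|rewrite -derive1E exp_derive1].
  apply: is_derive_eq (is_derive_add (is_derive_scalec (C / j.+1%:R) hX') (is_derive_opp hg)) _.
  by rewrite -[_ *: _]/(_ * _); congr (_ - _); field; rewrite ?pnatr_eq0 //; lra.
have H' s : s \in `]0, t[%R -> is_derive s (1 : R) psi (C * s ^+ j - dg s).
  by rewrite in_itv/= => /andP[s0 st]; apply: psid; rewrite !ltW.
have [|c] := MVT_segment t0 H'.
  apply: derivable_within_continuous => s; rewrite in_itv/= => st.
  by have [] := psid s st.
rewrite in_itv/= => ct e.
have : 0 <= psi t - psi 0 by rewrite e mulr_ge0 ?subr_ge0// dgC.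
rewrite /psi g0 expr0n /= mulr0 !subr0 subr_ge0 => /le_trans; apply.
by rewrite mulrAC.
Qed.

(** The quotient [k ^ k / k!] is one term of the exponential series at [k]. *)
Lemma expn_fact_le (k : nat) : k%:R ^+ k <= expR 1 ^+ k * k`!%:R :> R.
Proof.
case: k => [|k]; first by rewrite !expr0 mul1r.
have := expR_ge1Dxn k (ler0n R k.+1); rewrite -[X in expR X]mulr1 expRM_natl.
rewrite -ler_pdivrMr ?ltr0n ?fact_gt0// => /(le_trans _); apply.
by rewrite lerDr.
Qed.
(** Taylor's remainder at a zero of infinite order. Each integration along the segment from [z]
    lowers the order of the derivative by one; the two components of [w] contribute [h] each, and
    the powers of [t] integrate to the factorial. *)
Lemma taylor_bound A B z (w : R * R) (h S : R) (K : nat) :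
  cauchy_riemann_seq A B ->
  (forall k, A k z = 0 /\ B k z = 0) ->
  `|w.1| <= h -> `|w.2| <= h ->
  (forall t, 0 <= t <= 1 -> U (z + t *: w)) ->
  (forall t, 0 <= t <= 1 -> `|A K (z + t *: w)| <= S /\ `|B K (z + t *: w)| <= S) ->
  `|A 0%N (z + w)| <= S * (2 * h) ^+ K / K`!%:R /\
  `|B 0%N (z + w)| <= S * (2 * h) ^+ K / K`!%:R.
Proof.
move=> CR AB0 w1 w2 seg SK.
have h0 : 0 <= h by exact: le_trans w1.
suff H j t : (j <= K)%N -> 0 <= t <= 1 ->
    `|A (K - j)%N (z + t *: w)| <= S * (2 * h) ^+ j / j`!%:R * t ^+ j /\
    `|B (K - j)%N (z + t *: w)| <= S * (2 * h) ^+ j / j`!%:R * t ^+ j.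
  have := H K 1 (leqnn K); rewrite subnn expr1n mulr1 scale1r; apply.
  by rewrite ler01 lexx.
elim: j t => [|j IH] t jK /andP[t0 t1].
  by rewrite subn0 !expr0 fact0 !mulr1 divr1; apply: SK; rewrite t0.
have dline (s : R) : 0 <= s <= t ->
    let Q := z + s *: w in let k := (K - j.+1)%N in
    is_derive s (1 : R) (fun s => A k (z + s *: w)) (w.1 * A k.+1 Q - w.2 * B k.+1 Q) /\
    is_derive s (1 : R) (fun s => B k (z + s *: w)) (w.1 * B k.+1 Q + w.2 * A k.+1 Q).
  move=> /andP[s0 st] Q k.
  have UQ : U Q by apply: seg; rewrite s0 (le_trans st).
  exact: (@cauchy_riemann_curve _ U _ _ _ _ Uo (CR k) (fun s => z.1 + s * w.1)
    (fun s => z.2 + s * w.2) s w.1 w.2 UQ (is_derive_affine _ _ _) (is_derive_affine _ _ _)).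
have kE : (K - j.+1).+1 = (K - j)%N by rewrite subnSK.
have bnd (s : R) : 0 <= s <= t ->
    let Q := z + s *: w in let k := (K - j.+1)%N in
    `|w.1 * A k.+1 Q - w.2 * B k.+1 Q| <= S * (2 * h) ^+ j.+1 / j`!%:R * s ^+ j /\
    `|w.1 * B k.+1 Q + w.2 * A k.+1 Q| <= S * (2 * h) ^+ j.+1 / j`!%:R * s ^+ j.
  move=> /andP[s0 st] Q k; rewrite kE.
  have [|hA hB] := IH s (ltnW jK); first by rewrite s0 (le_trans st).
  have -> : S * (2 * h) ^+ j.+1 / j`!%:R * s ^+ j =
    h * (S * (2 * h) ^+ j / j`!%:R * s ^+ j) + h * (S * (2 * h) ^+ j / j`!%:R * s ^+ j).
    by rewrite exprS; ring.
  split; [apply: le_trans (ler_normB _ _) _|apply: le_trans (ler_normD _ _) _];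
    by rewrite !normrM lerD// ler_pM.
have AB00 k : A k (z + (0 : R) *: w) = 0 /\ B k (z + (0 : R) *: w) = 0.
  by rewrite scale0r addr0.
have e : S * (2 * h) ^+ j.+1 / j.+1`!%:R * t ^+ j.+1 =
    S * (2 * h) ^+ j.+1 / j`!%:R * t ^+ j.+1 / j.+1%:R.
  rewrite factS natrM.
  have x0 : j.+1%:R != 0 :> R by rewrite pnatr_eq0.
  have y0 : j`!%:R != 0 :> R by rewrite pnatr_eq0 -lt0n fact_gt0.
  by move: (j.+1%:R) (j`!%:R) x0 y0 => x y x0 y0; field; rewrite x0 y0.
rewrite e; split.
  apply: (@norm_le_of_derive_le (fun s => A (K - j.+1)%N (z + s *: w)) _ _ t j t0
    (AB00 _).1) => s st; [exact: (dline s st).1|exact: (bnd s st).1].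
apply: (@norm_le_of_derive_le (fun s => B (K - j.+1)%N (z + s *: w)) _ _ t j t0
  (AB00 _).2) => s st; [exact: (dline s st).2|exact: (bnd s st).2].
Qed.

Lemma cauchy_riemann_seq_vanish A B z : cauchy_riemann_seq A B -> U z ->
  (forall k, A k z = 0 /\ B k z = 0) ->
  \forall p \near z, A 0%N p = 0 /\ B 0%N p = 0.
Proof.
move=> CR Uz AB0.
have [Ac Bc] := cauchy_riemann_continuous Uo (CR 0%N) Uz.
have [rho rho0 zM] : exists2 rho : R, 0 < rho & forall p, ball z (2 * rho) p ->
    [/\ U p, `|A 0%N p| <= 1 & `|B 0%N p| <= 1].
  have : \forall p \near z, [/\ U p, `|A 0%N p| <= 1 & `|B 0%N p| <= 1].
    move/cvgrPdist_le : Ac => /(_ _ ltr01) Ac; move/cvgrPdist_le : Bc => /(_ _ ltr01) Bc.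
    rewrite (AB0 0%N).1 in Ac; rewrite (AB0 0%N).2 in Bc.
    near=> p; split.
    - by near: p; exact: open_nbhs_nbhs.
    - by rewrite -normrN -sub0r; near: p.
    - by rewrite -normrN -sub0r; near: p.
  move=> /nbhs_ballP[e /= e0 ze]; exists (e / 2); first by rewrite divr_gt0.
  by move=> p; rewrite mulrC divfK// => /ze.
have e0 : 0 < expR 1 :> R := expR_gt0 1.
(* The Cauchy estimate gives [(4 K / rho) ^ K] and the remainder gives [(2 h) ^ K / K!]. With this
   [h] their product is [(K / (2 e)) ^ K / K!], at most [2 ^ - K] by [expn_fact_le]. *)
pose h := rho / (16 * expR 1).
have h0 : 0 < h by rewrite divr_gt0// mulr_gt0.
have hrho : h <= rho.
  rewrite /h ler_pdivrMr ?mulr_gt0// ler_peMr ?ltW//.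
  have : 1 <= expR 1 :> R by rewrite -expR0 ler_expR.
  lra.
have key p (K : nat) : (0 < K)%N -> ball z h p ->
    `|A 0%N p| <= 2^-1 ^+ K /\ `|B 0%N p| <= 2^-1 ^+ K.
  move=> K0 /ball_pairP[zp1 zp2].
  have K0' : 0 < K%:R :> R by rewrite ltr0n.
  pose w : R * R := (p.1 - z.1, p.2 - z.2).
  have pE : p = z + w.
    transitivity (z.1 + (p.1 - z.1), z.2 + (p.2 - z.2)); last by [].
    by rewrite [z.1 + _]addrC [z.2 + _]addrC !subrK -surjective_pairing.
  have seg (t : R) : 0 <= t <= 1 -> ball z rho (z + t *: w).
    move=> /andP[t0 t1]; apply/ball_pairP.
    have bd (x : R) : `|x| < h -> `|t * x| < rho.
      move=> xh; rewrite normrM ger0_norm//; apply: lt_le_trans hrho.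
      by apply: le_lt_trans xh; rewrite ler_piMl.
    split; rewrite /= opprD addrA subrr add0r normrN; apply: bd; rewrite distrC.
      by [].
    by [].
  have sub : ball z rho `<=` ball z (2 * rho) by apply: le_ball; lra.
  pose S : R := 1 * (4 * K%:R / rho) ^+ K.
  have est := cauchy_estimate_iter CR rho0 (fun q zq => let: And3 u _ _ := zM q zq in u) K0
    (fun q zq => let: And3 _ x y := zM q zq in conj x y).
  have := taylor_bound CR AB0 (w := w) (h := h) (S := S) (K := K).
  rewrite -pE /= (distrC p.1) (distrC p.2) (ltW zp1) (ltW zp2) => /(_ isT isT) T.
  have {}T : `|A 0%N p| <= S * (2 * h) ^+ K / K`!%:R /\ `|B 0%N p| <= S * (2 * h) ^+ K / K`!%:R.
    apply: T => t t01; last exact: est (seg t t01).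
    by have [] := zM _ (sub _ (seg t t01)).
  suff le : S * (2 * h) ^+ K / K`!%:R <= 2^-1 ^+ K.
    by case: T => T1 T2; split; exact: le_trans le.
  rewrite ler_pdivrMr ?ltr0n ?fact_gt0// /S mul1r -exprMn.
  have -> : 4 * K%:R / rho * (2 * h) = 2^-1 * (expR 1)^-1 * K%:R.
    by rewrite /h; field; rewrite !gt_eqF.
  rewrite !exprMn -mulrA ler_pM2l ?exprn_gt0// exprVn ler_pdivrMl ?exprn_gt0//.
  exact: expn_fact_le.
apply/nbhs_ballP; exists h => //= p zp.
have zero (x : R) : (forall K, (0 < K)%N -> `|x| <= 2^-1 ^+ K) -> x = 0.
  move=> H; apply/eqP; rewrite -normr_le0 leNgt; apply/negP => x0.
  have hh : `|2^-1 : R| < 1 by rewrite gtr0_norm; lra.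
  have /cvgrPdist_lt/(_ _ x0)[N _ HN] := @cvg_expr R 2^-1 hh.
  have := HN N.+1 (leqnSn N); rewrite /= sub0r normrN normrX ger0_norm; last by lra.
  by rewrite ltNge H.
by split; apply: zero => K K0; have [] := key p K K0 zp.
Unshelve. all: by end_near. Qed.

Lemma is_derive_near0 (f : R -> R) (x df : R) : (\forall y \near x, f y = 0) ->
  is_derive x 1 f df -> df = 0.
Proof.
move=> f0 [_ <-]; rewrite (@near_eq_derive _ _ _ f (fun=> 0))// ?derive_cst//.
Qed.

Lemma cauchy_riemann_seq_vanish_all A B z : cauchy_riemann_seq A B -> U z ->
  (forall k, A k z = 0 /\ B k z = 0) ->
  \forall p \near z, forall k, A k p = 0 /\ B k p = 0.
Proof.
move=> CR Uz AB0.
have : \forall p \near z, U p /\ (A 0%N p = 0 /\ B 0%N p = 0).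
  apply: filterI; first exact: open_nbhs_nbhs.
  exact: cauchy_riemann_seq_vanish.
move=> /nbhs_ballP[e /= e0 H]; apply/nbhs_ballP; exists e => // p zp k.
elim: k p zp => [|k IH] p zp; first by have [] := H p zp.
have [[a1 _ b1 _] _] := CR k p (H p zp).1.
have near0 := near_ball_line_x zp.
split; [apply: is_derive_near0 a1|apply: is_derive_near0 b1];
  by apply: filterS near0 => t /IH[].
Qed.

(** The set [Z] of zeros of infinite order is closed in [U] by continuity and open by
    [cauchy_riemann_seq_vanish_all]. It contains [(u0, 0)] because the complex derivatives on the
    real axis are iterated [u]-derivatives there. *)
Theorem identity_theorem A B (u0 : R) : connected U -> cauchy_riemann_seq A B ->
  U (u0, 0) -> (\forall u \near u0, A 0%N (u, 0) = 0 /\ B 0%N (u, 0) = 0) ->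
  forall p, U p -> A 0%N p = 0 /\ B 0%N p = 0.
Proof.
move=> Uc CR Uu0 AB0.
have Uline : \forall u \near u0, U (u, 0).
  have /nbhs_ballP[e /= e0 H] := open_nbhs_nbhs (conj Uo Uu0).
  have zz : ball (u0, 0 : R) e (u0, 0 : R) by exact: ballxx.
  by apply: filterS (near_ball_line_x zz) => t /H.
have AB k : \forall u \near u0, A k (u, 0) = 0 /\ B k (u, 0) = 0.
  elim: k => [//|k IH].
  have : \forall u \near u0, U (u, 0) /\
      \forall v \near u, A k (v, 0) = 0 /\ B k (v, 0) = 0.
    by apply: filterI => //; exact: nbhs_interior IH.
  apply: filterS => u [/(CR k)[[a1 _ b1 _] _] H].
  split; [apply: is_derive_near0 a1|apply: is_derive_near0 b1];
    by apply: filterS H => v [].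
pose Z := [set p | U p /\ forall k, A k p = 0 /\ B k p = 0].
have ZU : Z = U.
  apply: Uc.
  - by exists (u0, 0); split => // k; exact: nbhs_singleton (AB k).
  - exists (interior [set p | forall k, A k p = 0 /\ B k p = 0]).
      exact: open_interior.
    apply/seteqP; split=> p [Up H]; split => //.
      exact: cauchy_riemann_seq_vanish_all.
    exact: nbhs_singleton H.
  - exists (closure Z); first exact: closed_closure.
    apply/seteqP; split=> p; first by move=> Zp; split; [case: Zp|exact: subset_closure].
    move=> [Up clp]; split => // k.
    have [Ac Bc] := cauchy_riemann_continuous Uo (CR k) Up.
    suff cl0 c : {for p, continuous c} -> (forall q, Z q -> c q = 0) -> c p = 0.
      by split; apply: cl0 => // q [_ /(_ k)[]].
    move=> cc c0; apply/eqP; apply: contrapT => /negP cp.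
    have [q [Zq]] := clp _ (cvgr_neq0 _ cc cp).
    by rewrite /= c0// eqxx.
by move=> p; rewrite -{1}ZU => -[_ /(_ 0%N)].
Qed.

End IdentityTheorem.

(** * Clifford-valued functions *)

Section CliffordCalculus.
Context {R : realType} {n : nat}.
Local Notation C := (clifford R n).

Lemma continuous_cliff_coord (A : {set 'I_n}) : continuous (@cliff_coord R n A).
Proof. exact: coord_continuous. Qed.

Lemma continuous_constant (S T : topologicalType) (w : T) (x : S) :
  {for x, continuous (fun=> w)}.
Proof. exact: cvg_cst. Qed.

Lemma continuous_bigsum (T : topologicalType) (V : normedModType R) (I : Type)
    (r : seq I) (P : pred I) (h : I -> T -> V) (x : T) :
  (forall i, {for x, continuous (h i)}) ->
  {for x, continuous (fun y => \sum_(i <- r | P i) h i y)}.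
Proof.
move=> H; elim: r => [|i r IH].
  rewrite (_ : (fun y => _) = fun=> 0); first exact: cvg_cst.
  by apply/funext => y; rewrite big_nil.
rewrite (_ : (fun y => _) = fun y => (if P i then h i y else 0) +
    \sum_(i <- r | P i) h i y); last first.
  by apply/funext => y; rewrite big_cons; case: ifP => // _; rewrite add0r.
apply: cvgD => //; case: ifP => _; first exact: H.
exact: cvg_cst.
Qed.

Lemma continuous_scale_fun (T : topologicalType) (V : normedModType R)
    (k : T -> R) (h : T -> V) (x : T) :
  {for x, continuous k} -> {for x, continuous h} ->
  {for x, continuous (fun y => k y *: h y)}.
Proof. by move=> kc hc; exact: cvgZ kc hc. Qed.

Lemma clifford_linear_continuous (V : normedModType R) (L : {linear C -> V}) :
  continuous L.
Proof.
have -> : (L : C -> V) = fun x => \sum_A cliff_coord A x *: L (blade A).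
  apply/funext => x; rewrite {1}(blade_decomp x) linear_sum.
  by apply: eq_bigr => A _; rewrite linearZ.
move=> x; apply: continuous_bigsum => A; apply: continuous_scale_fun.
  exact: continuous_cliff_coord.
exact: continuous_constant.
Qed.

Definition cliff_lmul (J : C) (x : C) : C := J * x.

Lemma cliff_lmul_is_linear J : linear (cliff_lmul J).
Proof. by move=> k x y; rewrite /cliff_lmul mulrDr -scalerAr. Qed.

HB.instance Definition _ J :=
  GRing.isLinear.Build R C C *:%R (cliff_lmul J) (cliff_lmul_is_linear J).

Lemma is_derive_lmul (V : normedModType R) (J : C) (f : V -> C) x v df :
  is_derive x v f df -> is_derive x v (fun y => J * f y) (J * df).
Proof.
apply: (@is_derive_linear _ _ _ _ (cliff_lmul J)).
exact: clifford_linear_continuous.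
Qed.

Lemma continuous_lmul (T : topologicalType) (J : C) (f : T -> C) x :
  {for x, continuous f} -> {for x, continuous (fun y => J * f y)}.
Proof.
move=> fc; apply: (@continuous_comp _ _ _ f (cliff_lmul J) x fc).
exact: (@clifford_linear_continuous _ (cliff_lmul J)).
Qed.

Lemma is_derive_coord (V : normedModType R) (A : {set 'I_n}) (f : V -> C) x v df :
  is_derive x v f df ->
  is_derive x v (fun y => cliff_coord A (f y)) (cliff_coord A df).
Proof.
exact: (@is_derive_linear _ _ _ _ (@cliff_coord R n A) _ _ _ _ (@continuous_cliff_coord A)).
Qed.

Lemma is_derive_of_coord (V : normedModType R) (f : V -> C) x v df :
  (forall A, is_derive x v (fun y => cliff_coord A (f y)) (cliff_coord A df)) ->
  is_derive x v f df.
Proof.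
move=> H; rewrite (blade_decomp df).
have -> : f = fun y => \sum_A cliff_coord A (f y) *: blade A.
  by apply/funext => y; exact: blade_decomp.
apply: is_derive_bigsum => A _.
have := is_derive_scale (H A) (is_derive_const (blade A : C) x v).
by rewrite scaler0 addr0.
Qed.

Lemma continuous_of_coord (T : topologicalType) (f : T -> C) x :
  (forall A, {for x, continuous (fun y => cliff_coord A (f y))}) ->
  {for x, continuous f}.
Proof.
move=> H; have -> : f = fun y => \sum_A cliff_coord A (f y) *: blade A.
  by apply/funext => y; exact: blade_decomp.
apply: continuous_bigsum => A; apply: continuous_scale_fun => //.
exact: continuous_constant.
Qed.

Definition vector_part (x : 'rV[R]_n.+1) : C :=
  \sum_(l < n) x ord0 (lift ord0 l) *: gen l.

Lemma vector_part_sqr x : vector_part x * vector_part x =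
  - (\sum_(l < n) x ord0 (lift ord0 l) ^+ 2) *: 1.
Proof.
pose y l := x ord0 (lift ord0 l).
have E : vector_part x * vector_part x =
    \sum_l \sum_m (y l * y m) *: (gen l * gen m : C).
  rewrite /vector_part big_distrl /=; apply: eq_bigr => l _.
  rewrite big_distrr /=; apply: eq_bigr => m _.
  by rewrite -scalerAl -scalerAr scalerA.
have E2 : vector_part x * vector_part x =
    \sum_l \sum_m (y l * y m) *: (gen m * gen l : C).
  rewrite E exchange_big /=; apply: eq_bigr => l _; apply: eq_bigr => m _.
  by rewrite mulrC.
(* Twice the square is a sum of anticommutators of generators, of which only the diagonal ones
   survive. *)
have two : vector_part x * vector_part x + vector_part x * vector_part x =
    2 *: (- (\sum_l y l ^+ 2) *: (1 : C)).
  rewrite {1}E E2 -big_split /= scalerA mulrN -mulNr mulr_sumr scaler_suml.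
  apply: eq_bigr => l _; rewrite -big_split /= (bigD1 l) //= big1 => [|m ml].
    rewrite addr0 -scalerDr gen_sqr -expr2 -opprD scalerN -scaleNr.
    by rewrite scalerDr -scalerDl; congr (_ *: _); ring.
  by rewrite -scalerDr gen_anticomm ?scaler0// eq_sym.
have two0 : 2 != 0 :> R by rewrite pnatr_eq0.
by apply: (scalerI two0); rewrite -two scaler_nat mulr2n.
Qed.

Lemma paravectorE (x : 'rV[R]_n.+1) :
  paravector x = (x ord0 ord0)%:A + vector_part x.
Proof. by []. Qed.

Lemma unit_sphere_sqr I : unit_sphere I -> paravector I * paravector I = -1 :> C.
Proof.
move=> [I0 I1]; rewrite paravectorE I0 scale0r add0r vector_part_sqr I1.
by rewrite scaleN1r.
Qed.

End CliffordCalculus.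

(** * Holomorphic functions on a slice *)

Section SliceHolomorphic.
Context {R : realType} {n : nat}.
Local Notation C := (clifford R n).
Variable U : set (R * R).
Hypothesis Uo : open U.
Variable J : C.
Hypothesis J2 : J * J = -1.
Implicit Types g h : R * R -> C.

Definition slice_holomorphic g g' := forall p, U p ->
  [/\ is_derive p.1 (1 : R) (fun t => g (t, p.2)) (g' p),
      is_derive p.2 (1 : R) (fun t => g (p.1, t)) (J * g' p) &
      {for p, continuous g'}].

(** The map sending [x] to [cliff_coord A x + i cliff_coord A (- J * x)] carries left multiplication
    by [J] to multiplication by [i], so it turns [g] into an ordinary holomorphic function. *)
Lemma slice_holomorphic_coord g g' (A : {set 'I_n}) : slice_holomorphic g g' ->
  cauchy_riemann U (fun p => cliff_coord A (g p)) (fun p => cliff_coord A (- J * g p))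
    (fun p => cliff_coord A (g' p)) (fun p => cliff_coord A (- J * g' p)).
Proof.
move=> H p /H[gx gy gc]; split; last first.
  split.
    exact: (@continuous_comp _ _ _ g' (@cliff_coord R n A) p gc (@continuous_cliff_coord _ _ A _)).
  exact: (@continuous_comp _ _ _ (fun p => - J * g' p) (@cliff_coord R n A) p
    (@continuous_lmul _ _ _ (- J) _ _ gc) (@continuous_cliff_coord _ _ A _)).
split.
- exact: is_derive_coord.
- by rewrite -linearN mulNr opprK; exact: is_derive_coord.
- by apply: is_derive_coord; exact: is_derive_lmul.
- have := is_derive_coord A (is_derive_lmul (- J) gy).
  by rewrite mulrA mulNr J2 opprK mul1r.
Qed.

Lemma slice_holomorphic_derivative g g' : slice_holomorphic g g' ->
  exists g'', slice_holomorphic g' g''.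
Proof.
move=> H.
have CR A := cauchy_riemann_derivative Uo (slice_holomorphic_coord A H).
have [e He] := choice CR.
pose g'' p : C := \sum_A e A p *: blade A.
have g''E A p : cliff_coord A (g'' p) = e A p.
  rewrite /g'' linear_sum (bigD1 A) //= linearZ /= coordE eqxx mulr1.
  by rewrite big1 ?addr0// => B /negbTE BA; rewrite linearZ /= coordE BA mulr0.
have g''x p : U p -> is_derive p.1 (1 : R) (fun t => g' (t, p.2)) (g'' p).
  move=> Up; apply: is_derive_of_coord => A; rewrite g''E.
  by have [f /(_ p Up)[[]]] := He A.
exists g'' => p Up; split; first exact: g''x.
  apply: is_derive_of_coord => A.
  have [f /(_ p Up)[[_ hy hf _] _]] := He A.
  (* Both sides are [u]-derivatives of the same coordinate of [J * g'], hence the chosen partners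
     [f] fit together with [g'']. *)
  have -> : cliff_coord A (J * g'' p) = - f p.
    have [_ <-] := hf.
    have [_ ->] := is_derive_coord A (is_derive_lmul (- J) (g''x p Up)).
    by rewrite mulNr linearN opprK.
  exact: hy.
apply: continuous_of_coord => A.
rewrite (_ : (fun y => _) = e A); last by apply/funext => y; rewrite g''E.
by have [f /(_ p Up)[_ []]] := He A.
Qed.

Lemma slice_holomorphic_seq g g' : slice_holomorphic g g' ->
  exists G : nat -> R * R -> C, G 0%N = g /\
    forall k, slice_holomorphic (G k) (G k.+1).
Proof.
move=> H.
pose D h := xget h [set h' | slice_holomorphic h h'].
pose G k := iter k D g.
have HG k : exists h', slice_holomorphic (G k) h'.
  elim: k => [|k [h' Hh']]; first by exists g'.
  apply: (@slice_holomorphic_derivative (G k)).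
  exact: (@xgetPex _ (G k) [set h' | slice_holomorphic (G k) h'] (ex_intro _ h' Hh')).
exists G; split; first by [].
move=> k; exact: (@xgetPex _ (G k) [set h' | slice_holomorphic (G k) h'] (HG k)).
Qed.

Lemma slice_holomorphic_identity g g' (u0 : R) : connected U ->
  slice_holomorphic g g' -> U (u0, 0) -> (\forall u \near u0, g (u, 0) = 0) ->
  forall p, U p -> g p = 0.
Proof.
move=> Uc H Uu0 g0 p Up.
have [G [G0 HG]] := slice_holomorphic_seq H.
apply: coordP => A; rewrite linear0.
pose a k p := cliff_coord A (G k p); pose b k p := cliff_coord A (- J * G k p).
have CR : cauchy_riemann_seq U a b by move=> k; exact: slice_holomorphic_coord.
have ab0 : \forall u \near u0, a 0%N (u, 0) = 0 /\ b 0%N (u, 0) = 0.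
  by apply: filterS g0 => u e; rewrite /a /b G0 e mulr0 linear0.
by have [<- _] := identity_theorem Uo Uc CR Uu0 ab0 Up; rewrite /a G0.
Qed.

End SliceHolomorphic.

Section PairDerivatives.
Context {R : realType} {V : normedModType R}.
Implicit Types (g : R * R -> V) (p : R * R).

Lemma is_derive_fst g p dg : is_derive p (1, 0) g dg ->
  is_derive p.1 (1 : R) (fun t => g (t, p.2)) dg.
Proof.
move=> /is_derive_cvg H; apply/is_derive_cvg.
rewrite (_ : (fun h : R => _) = fun h : R => h^-1 *: (g (h *: (1, 0) + p) - g p))//.
apply/funext => h; rewrite -surjective_pairing.
rewrite (_ : h *: (1, 0) + p = (h *: 1 + p.1, h *: 0 + p.2))//.
by rewrite scaler0 add0r.
Qed.

Lemma is_derive_snd g p dg : is_derive p (0, 1) g dg ->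
  is_derive p.2 (1 : R) (fun t => g (p.1, t)) dg.
Proof.
move=> /is_derive_cvg H; apply/is_derive_cvg.
rewrite (_ : (fun h : R => _) = fun h : R => h^-1 *: (g (h *: (0, 1) + p) - g p))//.
apply/funext => h; rewrite -surjective_pairing.
rewrite (_ : h *: (0, 1) + p = (h *: 0 + p.1, h *: 1 + p.2))//.
by rewrite scaler0 add0r.
Qed.

End PairDerivatives.

Section SliceHolomorphicRules.
Context {R : realType} {n : nat}.
Local Notation C := (clifford R n).
Variable U : set (R * R).
Hypothesis Uo : open U.
Variable J : C.
Implicit Types g h : R * R -> C.

Lemma slice_holomorphic_continuous g g' : J * J = -1 ->
  slice_holomorphic U J g g' -> forall p, U p -> {for p, continuous g}.
Proof.
move=> J2 H p Up; apply: continuous_of_coord => A.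
by have [] := cauchy_riemann_continuous Uo (slice_holomorphic_coord J2 A H) Up.
Qed.

Lemma slice_holomorphicB g g' h h' :
  slice_holomorphic U J g g' -> slice_holomorphic U J h h' ->
  slice_holomorphic U J (fun p => g p - h p) (fun p => g' p - h' p).
Proof.
move=> Hg Hh p Up; have [gx gy gc] := Hg p Up; have [hx hy hc] := Hh p Up; split.
- exact: is_derive_add gx (is_derive_opp hx).
- by rewrite mulrBr; exact: is_derive_add gy (is_derive_opp hy).
- exact: cvgB.
Qed.

End SliceHolomorphicRules.

(** * Geometry of slices *)

Section Slices.
Context {R : realType} {n : nat}.
Local Notation C := (clifford R n).
Local Notation point := 'rV[R]_n.+1.
Implicit Types (x I J : point) (u v : R) (Omega : set point).

Lemma slice_pt_re I u v : unit_sphere I -> slice_pt I u v ord0 ord0 = u.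
Proof. by move=> [I0 _]; rewrite !mxE I0 mulr0 addr0 !eqxx mulr1. Qed.

Lemma slice_pt_im I u v (l : 'I_n) :
  slice_pt I u v ord0 (lift ord0 l) = v * I ord0 (lift ord0 l).
Proof.
rewrite /slice_pt mxE [X in X + _]mxE [X in _ + X]mxE.
by rewrite (_ : basis_vec ord0 _ _ = 0) ?mulr0 ?add0r// mxE.
Qed.

Lemma paravector_slice_pt I u v : unit_sphere I ->
  paravector (slice_pt I u v) = u%:A + v *: paravector I :> C.
Proof.
move=> SI; rewrite /paravector slice_pt_re//; case: (SI) => -> _.
rewrite scale0r add0r scaler_sumr; congr (_ + _); apply: eq_bigr => l _.
by rewrite slice_pt_im scalerA.
Qed.

Lemma slice_pt_opp I u v : slice_pt I u (- v) = slice_pt (- I) u v.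
Proof. by rewrite /slice_pt scaleNr scalerN. Qed.

Lemma unit_sphere_opp I : unit_sphere I -> unit_sphere (- I).
Proof.
move=> [I0 I1]; split; first by rewrite mxE I0 oppr0.
by rewrite -I1; apply: eq_bigr => l _; rewrite mxE sqrrN.
Qed.

Lemma unit_sphere_basis (l : 'I_n) : unit_sphere (basis_vec (lift ord0 l) : point).
Proof.
split; first by rewrite mxE.
rewrite (bigD1 l) //= big1 => [|m ml]; first by rewrite mxE !eqxx expr1n addr0.
by rewrite mxE eqxx (inj_eq lift_inj) (negbTE ml) expr0n.
Qed.

Definition im_sqr x : R := \sum_(l < n) x ord0 (lift ord0 l) ^+ 2.

Lemma im_sqr_slice_pt I u v : unit_sphere I -> im_sqr (slice_pt I u v) = v ^+ 2.
Proof.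
move=> [_ I1]; rewrite /im_sqr; under eq_bigr do rewrite slice_pt_im exprMn.
by rewrite -mulr_sumr I1 mulr1.
Qed.

Lemma slice_pt_polar x : 0 < im_sqr x -> exists I, [/\ unit_sphere I,
  x = slice_pt I (x ord0 ord0) (Num.sqrt (im_sqr x)) &
  paravector I = (Num.sqrt (im_sqr x))^-1 *: vector_part x].
Proof.
move=> x0; set r := Num.sqrt _; have r0 : 0 < r by rewrite sqrtr_gt0.
pose I : point := \row_i (if i == ord0 then 0 else r^-1 * x ord0 i).
have Il l : I ord0 (lift ord0 l) = r^-1 * x ord0 (lift ord0 l) by rewrite mxE.
have SI : unit_sphere I.
  split; first by rewrite mxE eqxx.
  under eq_bigr do rewrite Il exprMn.
  by rewrite -mulr_sumr -/(im_sqr x) -(sqr_sqrtr (ltW x0)) -/r -exprMn mulVf ?gt_eqF// expr1n.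
exists I; split => //.
  apply/rowP => i; case: (unliftP ord0 i) => [l ->|->].
    by rewrite slice_pt_im Il mulVKf// gt_eqF.
  by rewrite slice_pt_re.
rewrite /paravector; case: (SI) => -> _; rewrite scale0r add0r /vector_part scaler_sumr.
by apply: eq_bigr => l _; rewrite Il scalerA.
Qed.

Lemma slice_pt_real x I : im_sqr x = 0 -> x = slice_pt I (x ord0 ord0) 0.
Proof.
move=> x0; rewrite /slice_pt scale0r addr0; apply/rowP => i.
case: (unliftP ord0 i) => [l ->|->]; last by rewrite !mxE !eqxx mulr1.
rewrite mxE (_ : basis_vec ord0 _ _ = 0) ?mulr0; last by rewrite mxE.
have /eqP := x0; rewrite psumr_eq0 => [/allP/(_ l)|m _]; last exact: sqr_ge0.
by rewrite mem_index_enum /= sqrf_eq0 => /(_ isT)/eqP.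
Qed.

Variables (Omega : set point) (hOmega : axially_symmetric_slice_domain Omega).

Lemma slice_indep I J : unit_sphere I -> unit_sphere J -> slice Omega I = slice Omega J.
Proof.
case: hOmega => _ _ _ sym SI SJ; apply/seteqP; split=> p; rewrite /slice /=.
  by move=> /sym; apply.
by move=> /sym; apply.
Qed.

Lemma slice_conj I p : unit_sphere I -> slice Omega I p -> slice Omega I (p.1, - p.2).
Proof.
move=> SI; rewrite {2}/slice /= slice_pt_opp => H.
by rewrite (slice_indep SI (unit_sphere_opp SI)) in H.
Qed.

Variables (f : point -> C) (hf : slice_monogenic Omega f).

Lemma slice_monogenic_holomorphic I : unit_sphere I -> exists g',
  slice_holomorphic (slice Omega I) (paravector I) (slice_restriction f I) g'.
Proof.
move=> SI; have [C1 CRf] := hf SI.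
exists (fun p => 'D_(1, 0) (slice_restriction f I) p) => p Up.
have [df /(_ (1, 0)) dc] := C1 p Up.
have dw w : is_derive p w (slice_restriction f I) ('D_w (slice_restriction f I) p).
  by apply: derivableP; exact: diff_derivable.
split; last exact: dc.
  exact: is_derive_fst (dw (1, 0)).
suff <- : 'D_(0, 1) (slice_restriction f I) p =
    paravector I * 'D_(1, 0) (slice_restriction f I) p.
  exact: is_derive_snd (dw (0, 1)).
(* Multiplying the Cauchy-Riemann equation by [I] on the left solves it for the [v]-derivative,
   since [I ^ 2 = -1]. *)
have := congr1 ( *%R (paravector I)) (CRf p Up).
rewrite mulr0 mulrDr mulrA (unit_sphere_sqr SI) mulN1r => /eqP.
by rewrite subr_eq0 => /eqP.
Qed.

End Slices.

(** * The representation formula *)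

Section Representation.
Context {R : realType} {n : nat}.
Local Notation C := (clifford R n).
Local Notation point := 'rV[R]_n.+1.
Implicit Types (I J : point).

(* [alpha 0] and [beta 0] are the components of a slice function              *)
(* [alpha + I beta]; those of its [k]-th slice derivative are [alpha k] and   *)
(* [beta k].                                                                  *)
Definition axial_seq (U : set (R * R)) (alpha beta : nat -> R * R -> C) :=
  forall k p, U p ->
  [/\ is_derive p.1 (1 : R) (fun t => alpha k (t, p.2)) (alpha k.+1 p),
      is_derive p.2 (1 : R) (fun t => alpha k (p.1, t)) (- beta k.+1 p),
      is_derive p.1 (1 : R) (fun t => beta k (t, p.2)) (beta k.+1 p) &
      is_derive p.2 (1 : R) (fun t => beta k (p.1, t)) (alpha k.+1 p)] /\
  {for p, continuous (alpha k)} /\ {for p, continuous (beta k)}.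

Lemma axial_seq_holomorphic U alpha beta (J : C) k : J * J = -1 ->
  axial_seq U alpha beta ->
  slice_holomorphic U J (fun p => alpha k p + J * beta k p)
    (fun p => alpha k.+1 p + J * beta k.+1 p).
Proof.
move=> J2 H p Up; have [[ax ay bx bY] _] := H k p Up.
have [_ [ac bc]] := H k.+1 p Up; split.
- exact: is_derive_add ax (is_derive_lmul J bx).
- rewrite mulrDr mulrA J2 mulN1r addrC.
  exact: is_derive_add ay (is_derive_lmul J bY).
- by apply: cvgD ac _; exact: (@continuous_lmul _ _ _ J (beta k.+1) p bc).
Qed.

Lemma is_derive_reflect (g : R -> C) (y : R) dg : is_derive (- y) (1 : R) g dg ->
  is_derive y (1 : R) (fun t => g (- t)) (- dg).
Proof.
move=> H; have := @is_derive_comp_real _ _ _ g (fun t => - t) y 1 (-1) dg H.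
by rewrite scaleN1r; apply; exact: is_derive_opp (is_derive_id _ _).
Qed.

(** The first component is the even part of [G] in [v], the second is [- J] times the odd part, so
    that [alpha + J beta = G]; the reflection [v -> - v] reverses the sign of [v]-derivatives. *)
Lemma conj_axial_seq U (J : C) (G : nat -> R * R -> C) : open U -> J * J = -1 ->
  (forall p, U p -> U (p.1, - p.2)) ->
  (forall k, slice_holomorphic U J (G k) (G k.+1)) ->
  axial_seq U
    (fun k p => 2^-1 *: (G k p + G k (p.1, - p.2)))
    (fun k p => - (2^-1 *: (J * (G k p - G k (p.1, - p.2))))).
Proof.
move=> Uo J2 Uconj HG k p Up; pose q := (p.1, - p.2).
have Uq : U q by exact: Uconj.
have [px py _] := HG k p Up; have [qx qy _] := HG k q Uq.
have pc := slice_holomorphic_continuous Uo J2 (HG k) Up.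
have qc := slice_holomorphic_continuous Uo J2 (HG k) Uq.
have qc' : {for p, continuous (fun p => G k (p.1, - p.2))}.
  apply: (@continuous_comp _ _ _ (fun p : R * R => (p.1, - p.2)) (G k) p _ qc).
  apply: continuous_pair_fun; first exact: cvg_fst.
  by apply: cvgN; exact: cvg_snd.
have qy' := @is_derive_reflect (fun t => G k (p.1, t)) p.2 _ qy.
split; last split.
- split.
  + exact: is_derive_scalec (is_derive_add px qx).
  + rewrite opprK mulrBr; exact: is_derive_scalec (is_derive_add py qy').
  + exact: is_derive_opp (is_derive_scalec _ (is_derive_lmul J (is_derive_add px (is_derive_opp qx)))).
  + apply: is_derive_eq (is_derive_opp (is_derive_scalec _ (is_derive_lmul J (is_derive_add py (is_derive_opp qy'))))) _.
    by rewrite opprK -mulrDr mulrA J2 mulN1r scalerN opprK.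
- by apply: cvgZl_tmp; exact: cvgD.
- apply: cvgN; apply: cvgZl_tmp.
  by apply: (@continuous_lmul _ _ _ J (fun p => G k p - G k (p.1, - p.2))); exact: cvgB.
Qed.

Variables (Omega : set point) (hOmega : axially_symmetric_slice_domain Omega).
Variables (f : point -> C) (hf : slice_monogenic Omega f).

Theorem slice_representation I : unit_sphere I -> exists alpha beta,
  axial_seq (slice Omega I) alpha beta /\
  forall J p, unit_sphere J -> slice Omega I p ->
    f (slice_pt J p.1 p.2) = alpha 0%N p + paravector J * beta 0%N p.
Proof.
move=> SI; set U := slice Omega I.
case: (hOmega) => _ [u0 Ou0] dom _; have [Uo Uc _] := dom I SI.
have Uu0 : U (u0, 0) by rewrite /U /slice /slice_pt /= scale0r addr0.
have [g' Hg'] := slice_monogenic_holomorphic hf SI.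
have I2 := unit_sphere_sqr SI.
have [G [G0 HG]] := slice_holomorphic_seq Uo I2 Hg'.
have Uconj p : U p -> U (p.1, - p.2) by exact: slice_conj.
have ab := conj_axial_seq Uo I2 Uconj HG.
set alpha := (X in axial_seq U X _) in ab.
set beta := (X in axial_seq U _ X) in ab.
exists alpha, beta; split => // J p SJ Up.
have J2 := unit_sphere_sqr SJ.
have [h' Hh'] := slice_monogenic_holomorphic hf SJ.
rewrite (slice_indep hOmega SJ SI) -/U in Hh'.
have Hd := slice_holomorphicB Hh' (axial_seq_holomorphic 0%N J2 ab).
suff : slice_restriction f J p - (alpha 0%N p + paravector J * beta 0%N p) = 0.
  by move=> /eqP; rewrite subr_eq0 => /eqP.
apply: (slice_holomorphic_identity Uo J2 Uc Hd Uu0 _ Up).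
(* At [v = 0] the odd part vanishes and [alpha] is the value of [f], whatever the slice; the
   identity theorem needs no more. *)
near=> u; rewrite /alpha /beta /= oppr0 subrr mulr0 scaler0 oppr0 mulr0 addr0.
rewrite -mulr2n -[G _ _ *+ 2]scaler_nat scalerA mulVf ?pnatr_eq0// scale1r G0.
by rewrite /slice_restriction /slice_pt /= !scale0r subrr.
Unshelve. all: by end_near. Qed.

End Representation.

(** * The Laplacian of an axially symmetric function *)

Section LaplacianRules.
Context {R : realType} {n : nat}.
Local Notation C := (clifford R n).
Local Notation point := 'rV[R]_n.+1.
Implicit Types (F G L : point -> C) (O : set point) (x : point).

(** Carries witnesses for the first and second partial derivatives, so that sums and scalar
    multiples need no separate differentiability conditions. On an open [O] derivatives are local,
    and [is_laplacian_eq] returns to [laplacian]. *)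
Definition is_laplacian O F L := exists D E : 'I_n.+1 -> point -> C,
  forall x, O x -> (forall i, is_derive x (basis_vec i) F (D i x) /\
    is_derive x (basis_vec i) (D i) (E i x)) /\ L x = \sum_i E i x.

Lemma is_laplacian_eq O f F L : open O -> is_laplacian O F L ->
  (forall x, O x -> f x = F x) -> forall x, O x -> laplacian f x = L x.
Proof.
move=> Oo [D [E H]] fF x Ox; have [_ ->] := H x Ox.
apply: eq_bigr => i _.
have Dy y : O y -> 'D_(basis_vec i) f y = D i y.
  move=> Oy; have [/(_ i)[[_ <-] _] _] := H y Oy.
  apply: near_eq_derive; apply: filterS (open_nbhs_nbhs (conj Oo Oy)) => z Oz.
  exact: fF.
have [/(_ i)[_ [_ <-]] _] := H x Ox.
by apply: near_eq_derive; apply: filterS (open_nbhs_nbhs (conj Oo Ox)).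
Qed.

Lemma is_laplacianD O F L G M : is_laplacian O F L -> is_laplacian O G M ->
  is_laplacian O (fun x => F x + G x) (fun x => L x + M x).
Proof.
move=> [D [E HF]] [D' [E' HG]].
exists (fun i x => D i x + D' i x), (fun i x => E i x + E' i x) => x Ox.
have [HF1 ->] := HF x Ox; have [HG1 ->] := HG x Ox.
split; last by rewrite big_split.
move=> i; have [f1 f2] := HF1 i; have [g1 g2] := HG1 i.
by split; exact: is_derive_add.
Qed.

Lemma is_laplacianZ O F L (k : R) : is_laplacian O F L ->
  is_laplacian O (fun x => k *: F x) (fun x => k *: L x).
Proof.
move=> [D [E HF]]; exists (fun i x => k *: D i x), (fun i x => k *: E i x) => x Ox.
have [HF1 ->] := HF x Ox; split; last by rewrite scaler_sumr.
by move=> i; have [f1 f2] := HF1 i; split; exact: is_derive_scalec.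
Qed.

Lemma is_laplacian0 O : is_laplacian O (fun=> 0) (fun=> 0).
Proof.
exists (fun _ _ => 0), (fun _ _ => 0) => x Ox; split; last by rewrite big1.
by move=> i; split; exact: is_derive_const.
Qed.

Lemma is_laplacian_sum O (I : Type) (r : seq I) (F L : I -> point -> C) :
  (forall i, is_laplacian O (F i) (L i)) ->
  is_laplacian O (fun x => \sum_(i <- r) F i x) (fun x => \sum_(i <- r) L i x).
Proof.
move=> H; elim: r => [|i r IH].
  rewrite (_ : (fun x => _) = fun=> 0); last by apply/funext => x; rewrite big_nil.
  rewrite [X in is_laplacian _ _ X](_ : _ = fun=> 0); last by apply/funext => x; rewrite big_nil.
  exact: is_laplacian0.
rewrite (_ : (fun x => _) = fun x => F i x + \sum_(j <- r) F j x); last first.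
  by apply/funext => x; rewrite big_cons.
rewrite [X in is_laplacian _ _ X](_ : _ = fun x => L i x + \sum_(j <- r) L j x); last first.
  by apply/funext => x; rewrite big_cons.
exact: is_laplacianD.
Qed.

Lemma iter_is_laplacian O f (F : nat -> point -> C) (c : nat -> R) : open O ->
  (forall x, O x -> f x = F 0%N x) ->
  (forall j, is_laplacian O (F j) (fun x => c j *: F j.+1 x)) ->
  forall m x, O x -> iter m laplacian f x = (\prod_(j < m) c j) *: F m x.
Proof.
move=> Oo fF HF; elim=> [|m IH] x Ox; first by rewrite big_ord0 scale1r; exact: fF.
rewrite iterS big_ord_recr /= -scalerA.
exact: (is_laplacian_eq Oo (is_laplacianZ _ (HF m)) IH).
Qed.

End LaplacianRules.

(** * Euler-Poisson-Darboux towers *)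

Section Towers.
Context {R : realType} {n : nat}.
Local Notation C := (clifford R n).
Local Notation point := 'rV[R]_n.+1.
Implicit Types (x : point) (W : set (R * R)) (q : R * R).

(* [T j k] is the mixed derivative of order [j] in [s] and [k] in [u] of a    *)
(* solution [T 0 0] of the Euler-Poisson-Darboux equation                     *)
(* [4 s T_ss + c T_s + T_uu = 0].                                             *)
Definition epd_tower W (c : R) (T : nat -> nat -> R * R -> C) :=
  forall j k q, W q ->
  [/\ is_derive q.1 (1 : R) (fun t => T j k (t, q.2)) (T j k.+1 q),
      is_derive q.2 (1 : R) (fun t => T j k (q.1, t)) (T j.+1 k q) &
      (4 * q.2) *: T j.+2 k q + (c + 4 * j%:R) *: T j.+1 k q + T j k.+2 q = 0].

Lemma epd_tower_lmul W c T (e : C) : epd_tower W c T ->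
  epd_tower W c (fun j k q => e * T j k q).
Proof.
move=> H j k q /(H j k)[h1 h2 h3]; split.
- exact: is_derive_lmul.
- exact: is_derive_lmul.
- by rewrite !scalerAr -!mulrDr h3 mulr0.
Qed.

Definition axial_coord x : R * R := (x ord0 ord0, im_sqr x).

Lemma basis_vec_coord (i j : 'I_n.+1) (h : R) x :
  (h *: basis_vec i + x) ord0 j = h * (j == i)%:R + x ord0 j.
Proof. by rewrite mxE mxE mxE eqxx. Qed.

Lemma is_derive_coord_fun (i j : 'I_n.+1) x :
  is_derive x (basis_vec i) (fun y : point => y ord0 j) ((j == i)%:R : R).
Proof.
apply/is_derive_line.
rewrite (_ : (fun h : R => _) = fun h => x ord0 j + h * (j == i)%:R).
  exact: is_derive_affine.
by apply/funext => h; rewrite basis_vec_coord addrC.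
Qed.

Lemma is_derive_im_sqr (l : 'I_n) x :
  is_derive x (basis_vec (lift ord0 l)) (@im_sqr R n) (2 * x ord0 (lift ord0 l)).
Proof.
rewrite (_ : @im_sqr R n = fun y => \sum_(m < n) y ord0 (lift ord0 m) *: (y ord0 (lift ord0 m) : R)); last first.
  by apply/funext => y; apply: eq_bigr => m _; rewrite expr2.
have -> : 2 * x ord0 (lift ord0 l) = \sum_(m < n)
   ((lift ord0 m == lift ord0 l)%:R *: (x ord0 (lift ord0 m) : R) +
    x ord0 (lift ord0 m) *: ((lift ord0 m == lift ord0 l)%:R : R)).
  rewrite (bigD1 l) //= big1 => [|m ml].
    by rewrite eqxx addr0 scale1r -[_ *: _]/(x ord0 (lift ord0 l) * 1); ring.
  by rewrite (inj_eq lift_inj) (negbTE ml) scale0r scaler0 addr0.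
apply: is_derive_bigsum => m _.
by apply: is_derive_scale; exact: is_derive_coord_fun.
Qed.

Lemma axial_coord_line0 (h : R) x :
  axial_coord (h *: basis_vec ord0 + x) = (x ord0 ord0 + h, im_sqr x).
Proof.
rewrite /axial_coord basis_vec_coord mulr1 addrC; congr pair.
by apply: eq_bigr => l _; rewrite basis_vec_coord mulr0 add0r.
Qed.

Lemma is_derive_axial0 W c T j k x : epd_tower W c T -> W (axial_coord x) ->
  is_derive x (basis_vec ord0) (fun y => T j k (axial_coord y)) (T j k.+1 (axial_coord x)).
Proof.
move=> H /(H j k)[hx _ _]; apply/is_derive_line.
rewrite (_ : (fun h : R => _) = fun h => T j k (h + x ord0 ord0, im_sqr x)).
  by apply: (@is_derive_translate _ _ (fun t => T j k (t, im_sqr x))); rewrite add0r.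
by apply/funext => h; rewrite axial_coord_line0 addrC.
Qed.

Lemma is_derive_axialS W c T j k x (l : 'I_n) : epd_tower W c T -> W (axial_coord x) ->
  is_derive x (basis_vec (lift ord0 l)) (fun y => T j k (axial_coord y))
    ((2 * x ord0 (lift ord0 l)) *: T j.+1 k (axial_coord x)).
Proof.
move=> H /(H j k)[_ hy _].
have := @is_derive_comp_real _ _ _ (fun t => T j k (x ord0 ord0, t)) (@im_sqr R n) x
  _ _ _ hy (is_derive_im_sqr l x).
move=> /is_derive_line h; apply/is_derive_line.
rewrite (_ : (fun h : R => _) = (fun h : R => T j k (x ord0 ord0,
  im_sqr (h *: basis_vec (lift ord0 l) + x))))//.
apply/funext => t; rewrite /axial_coord basis_vec_coord; congr (T j k (_, _)).
by rewrite mulr0 add0r.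
Qed.

(* The last hypothesis is Euler's identity: [w] is homogeneous of degree [d]  *)
(* in the vector part.                                                        *)
Lemma is_laplacian_axial W c T (w : point -> R) (e : 'I_n -> R) (d : R) j :
  epd_tower W c T ->
  (forall x, is_derive x (basis_vec ord0) w 0) ->
  (forall x l, is_derive x (basis_vec (lift ord0 l)) w (e l)) ->
  (forall x, \sum_l e l * x ord0 (lift ord0 l) = d * w x) ->
  is_laplacian [set x | W (axial_coord x)]
    (fun x => w x *: T j 0%N (axial_coord x))
    (fun x => (2 * n%:R + 4 * d - c - 4 * j%:R) *: (w x *: T j.+1 0%N (axial_coord x))).
Proof.
move=> HT w0 wS wE.
pose P j k (x : point) := T j k (axial_coord x).
exists (fun i x => if unlift ord0 i is Some l
  then e l *: P j 0%N x + (w x * (2 * x ord0 (lift ord0 l))) *: P j.+1 0%N x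
  else w x *: P j 1%N x).
exists (fun i x => if unlift ord0 i is Some l
  then e l *: ((2 * x ord0 (lift ord0 l)) *: P j.+1 0%N x) +
    ((e l * (2 * x ord0 (lift ord0 l)) + w x * 2) *: P j.+1 0%N x +
     (w x * (2 * x ord0 (lift ord0 l))) *: ((2 * x ord0 (lift ord0 l)) *: P j.+2 0%N x))
  else w x *: P j 2%N x).
move=> x Wx.
have P0 k m : is_derive x (basis_vec ord0) (P k m) (P k m.+1 x).
  exact: is_derive_axial0 HT Wx.
have PS k m l : is_derive x (basis_vec (lift ord0 l)) (P k m)
    ((2 * x ord0 (lift ord0 l)) *: P k.+1 m x).
  exact: is_derive_axialS HT Wx.
split.
  move=> i; case: (unliftP ord0 i) => [l ->|->].
    split.
      by have := is_derive_scale (wS x l) (PS j 0%N l); rewrite scalerA.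
    apply: is_derive_add (is_derive_scalec (e l) (PS j 0%N l)) _.
    apply: is_derive_scale (PS j.+1 0%N l).
    have Hx := is_derive_scalec 2 (is_derive_coord_fun (lift ord0 l) (lift ord0 l) x).
    have := is_derive_scale (wS x l) Hx.
    by rewrite eqxx -![_ *: _]/(_ * _) mulr1.
  split.
    by have := is_derive_scale (w0 x) (P0 j 0%N); rewrite scale0r add0r.
  by have := is_derive_scale (w0 x) (P0 j 1%N); rewrite scale0r add0r.
rewrite big_ord_recl unlift_none.
under eq_bigr do rewrite liftK.
(* In the sum over [l], Euler's identity turns the first terms into [4 d w], the second ones add up
   to [2 n w], and the squares add up to [s]. *)
rewrite (eq_bigr (fun l => (4 * (e l * x ord0 (lift ord0 l)) + 2 * w x) *: P j.+1 0%N x +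
    (4 * w x * x ord0 (lift ord0 l) ^+ 2) *: P j.+2 0%N x)); last first.
  move=> l _; rewrite addrA !scalerA -scalerDl; congr (_ *: _ + _ *: _); ring.
rewrite big_split /= -!scaler_suml -mulr_sumr big_split /= -mulr_sumr wE.
rewrite sumr_const card_ord -/(im_sqr x).
(* The equation replaces the second [u]-derivative; its term [4 s] cancels the one just found, and
   [- c - 4 j] is what remains. *)
have [_ _ /addr0_eq/esym E] := HT j 0%N _ Wx.
rewrite [P j 2%N x]E -!/(P _ _ x).
rewrite -[_.2]/(im_sqr x) -[2 * w x *+ n]mulr_natl.
move: (P j.+1 0%N x) (P j.+2 0%N x) => p q.
rewrite scalerN scalerDr opprD !scalerA [X in _ = _ + X]addrC addrACA.
rewrite -[- (_ *: q)]scaleNr -[- (_ *: p)]scaleNr -!scalerDl.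
have -> : - (w x * (4 * im_sqr x)) + 4 * w x * im_sqr x = 0 by ring.
by rewrite scale0r add0r; congr (_ *: _); ring.
Qed.

End Towers.

Section CoordinateRules.
Context {R : realType} {n : nat}.
Implicit Types (D : {set 'I_n}) (x y : clifford R n).

Lemma cliff_coordD D x y : cliff_coord D (x + y) = cliff_coord D x + cliff_coord D y.
Proof. exact: linearD. Qed.

Lemma cliff_coordN D x : cliff_coord D (- x) = - cliff_coord D x.
Proof. exact: linearN. Qed.

Lemma cliff_coordZ D (k : R) x : cliff_coord D (k *: x) = k * cliff_coord D x.
Proof. exact: linearZ. Qed.

Definition cliff_coordE := (cliff_coordD, cliff_coordN, cliff_coordZ).

End CoordinateRules.

(** * The two components in the variable [s = v ^ 2] *)

Section AxialTowers.
Context {R : realType} {n : nat}.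
Local Notation C := (clifford R n).
Variables (U : set (R * R)) (alpha beta : nat -> R * R -> C).
Hypothesis Hab : axial_seq U alpha beta.
Implicit Types q : R * R.

(** The part [v > 0] of [D] in the coordinates [(u, s)] with [s = v ^ 2]; there the square root is
    differentiable and invertible. *)
Definition sqrt_domain (D : set (R * R)) : set (R * R) :=
  [set q | 0 < q.2 /\ D (q.1, Num.sqrt q.2)].

Let W := sqrt_domain U.
Let A k q : C := alpha k (q.1, Num.sqrt q.2).
(** Dividing by [v] turns [I beta] into [B] multiplied on the left by the vector part [v I]. *)
Let B k q : C := (Num.sqrt q.2)^-1 *: beta k (q.1, Num.sqrt q.2).

Let Au k q : W q -> is_derive q.1 (1 : R) (fun t => A k (t, q.2)) (A k.+1 q).
Proof. by move=> [_ /(Hab k)[[]]]. Qed.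

Let Bu k q : W q -> is_derive q.1 (1 : R) (fun t => B k (t, q.2)) (B k.+1 q).
Proof. by move=> [_ /(Hab k)[[_ _ h _] _]]; exact: (is_derive_scalec (Num.sqrt q.2)^-1 h). Qed.

Let As k q : W q ->
  is_derive q.2 (1 : R) (fun t => A k (q.1, t)) (- (2^-1 *: B k.+1 q)).
Proof.
move=> [q0 /(Hab k)[[_ h _ _] _]].
have := @is_derive_comp_real _ _ _ (fun t => alpha k (q.1, t)) Num.sqrt q.2 _ _ _ h
  (is_derive1_sqrt q0).
by rewrite invfM scalerN -scalerA.
Qed.

Let Bs k q : W q ->
  is_derive q.2 (1 : R) (fun t => B k (q.1, t)) ((2 * q.2)^-1 *: (A k.+1 q - B k q)).
Proof.
move=> [q0 /(Hab k)[[_ _ _ h] _]].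
have r0 : Num.sqrt q.2 != 0 by rewrite gt_eqF// sqrtr_gt0.
have Hs := is_derive1_sqrt q0.
have H := is_derive_scale (is_deriveV r0 Hs)
  (@is_derive_comp_real _ _ _ (fun t => beta k (q.1, t)) Num.sqrt q.2 _ _ _ h Hs).
apply: is_derive_eq H _.
rewrite /A /B; apply: coordP => D.
rewrite !cliff_coordE.
move: (cliff_coord D (alpha k.+1 _)) (cliff_coord D (beta k _)) => x y.
move: (Num.sqrt q.2) r0 (sqr_sqrtr (ltW q0)) => r r0 <-.
by rewrite -![_ *: _]/(_ * _); field.
Qed.

Let scale_inv (k : R) q : W q -> is_derive q.2 (1 : R) (fun t => (k * t)^-1) (- (k * q.2 ^+ 2)^-1).
Proof.
move=> [q0 _]; have [->|k0] := eqVneq k 0.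
  rewrite mul0r invr0 oppr0 (_ : (fun t => _) = fun=> 0); first exact: is_derive_const.
  by apply/funext => t; rewrite mul0r invr0.
have kq0 : k * q.2 != 0 by rewrite mulf_neq0// gt_eqF.
have H1 : is_derive q.2 (1 : R) (fun t => k * t) (k * 1).
  exact: is_derive_scalec (is_derive_id _ _).
apply: is_derive_eq (is_deriveV kq0 H1) _.
by rewrite -[_ *: _]/(_ * _) mulr1; field; rewrite k0 gt_eqF.
Qed.

(** The first [s]-derivative of [B] comes from the Cauchy-Riemann equations; the later ones are
    obtained by solving the equation with [c = 6] for its highest term. The equation thus holds by
    construction, and [Ts] shows that the entries are indeed successive [s]-derivatives. *)
Fixpoint odd_tower (j k : nat) (q : R * R) {struct j} : C :=
  match j with
  | 0 => B k q
  | j'.+1 => match j' with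
    | 0 => (2 * q.2)^-1 *: (A k.+1 q - B k q)
    | j''.+1 => - ((4 * q.2)^-1 *:
        ((6 + 4 * j''%:R) *: odd_tower j' k q + odd_tower j'' k.+2 q))
    end
  end.

(** The Cauchy-Riemann equations give [A_s = - B_u / 2], so all later [s]-derivatives of [A] are
    read off the tower of [B]. *)
Definition even_tower (j k : nat) (q : R * R) : C :=
  if j is j'.+1 then - (2^-1 *: odd_tower j' k.+1 q) else A k q.

Let T := odd_tower.

Let TE j k q : T j.+2 k q =
  - ((4 * q.2)^-1 *: ((6 + 4 * j%:R) *: T j.+1 k q + T j k.+2 q)).
Proof. by []. Qed.

Let Tu j k q : W q -> is_derive q.1 (1 : R) (fun t => T j k (t, q.2)) (T j k.+1 q).
Proof.
move=> Wq.
suff : (forall k, is_derive q.1 (1 : R) (fun t => T j k (t, q.2)) (T j k.+1 q)) /\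
  (forall k, is_derive q.1 (1 : R) (fun t => T j.+1 k (t, q.2)) (T j.+1 k.+1 q)).
  by case.
elim: j => [|j [IH1 IH2]]; split => {}k.
- exact: Bu.
- exact: (is_derive_scalec (2 * q.2)^-1
    (is_derive_add (Au k.+1 Wq) (is_derive_opp (Bu k Wq)))).
- exact: IH2.
- exact: (is_derive_opp (is_derive_scalec (4 * q.2)^-1
    (is_derive_add (is_derive_scalec (6 + 4 * j%:R) (IH2 k)) (IH1 k.+2)))).
Qed.

Let Ts j k q : W q -> is_derive q.2 (1 : R) (fun t => T j k (q.1, t)) (T j.+1 k q).
Proof.
case: q => u s Wq; have [/= q0 _] := Wq; have q0' : s != 0 by rewrite gt_eqF.
suff : (forall k, is_derive s (1 : R) (fun t => T j k (u, t)) (T j.+1 k (u, s))) /\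
  (forall k, is_derive s (1 : R) (fun t => T j.+1 k (u, t)) (T j.+2 k (u, s))).
  by case.
(* The recursion defining the tower has two terms, so the induction carries two consecutive
   orders. *)
elim: j => [|j [IH1 IH2]]; split => {}k.
- exact: (Bs k Wq).
- have H := is_derive_scale (scale_inv 2 Wq)
    (is_derive_add (As k.+1 Wq) (is_derive_opp (Bs k Wq))).
  apply: is_derive_eq H _.
  rewrite TE /T /odd_tower; cbv beta iota delta [fst snd].
  move: (A k.+1 (u, s)) (B k (u, s)) (B k.+2 (u, s)) => a b b'.
  apply: coordP => D; rewrite !cliff_coordE; field; exact: q0'.
- exact: IH2.
- have H := is_derive_opp (is_derive_scale (scale_inv 4 Wq)
    (is_derive_add (is_derive_scalec (6 + 4 * j%:R) (IH2 k)) (IH1 k.+2))).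
  apply: is_derive_eq H _.
  rewrite [RHS]TE [T j.+2 k (u, s)]TE.
  cbv beta; move: (T j.+1 k (u, s)) (T j.+1 k.+2 (u, s)) (T j k.+2 (u, s)) => a b b'.
  apply: coordP => D; rewrite !cliff_coordE -(natr1 j); field; exact: q0'.
Qed.

Lemma odd_tower_epd : epd_tower W 6 odd_tower.
Proof.
move=> j k q Wq; split; [exact: Tu|exact: Ts|].
have q0 : 4 * q.2 != 0 by rewrite mulf_neq0// ?pnatr_eq0// gt_eqF//; case: Wq.
by rewrite -/T TE scalerN scalerA mulfV// scale1r -addrA addNr.
Qed.

Lemma even_tower_epd : epd_tower W 2 even_tower.
Proof.
move=> [|j] k q Wq; split.
- exact: Au.
- exact: As.
- have q0 : q.2 != 0 by rewrite gt_eqF//; case: Wq.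
  rewrite /even_tower /=; move: (A k.+2 q) (B k.+1 q) => a b.
  by apply: coordP => D; rewrite !cliff_coordE /cliff_coord mxE; field.
- exact: (is_derive_opp (is_derive_scalec 2^-1 (Tu j k.+1 Wq))).
- exact: (is_derive_opp (is_derive_scalec 2^-1 (Ts j k.+1 Wq))).
(* Since [2 + 4 (j + 1) = 6 + 4 j], this is [- 1 / 2] times the equation of order [j] of the odd
   tower. *)
- have [_ _ H] := odd_tower_epd j k.+1 Wq.
  rewrite /even_tower -[RHS](scaler0 _ (- 2^-1)) -[in RHS]H.
  rewrite -/T; move: (T j.+2 k.+1 q) (T j.+1 k.+1 q) (T j k.+3 q) => a b b'.
  by apply: coordP => D; rewrite !cliff_coordE -(natr1 j); field.
Qed.

End AxialTowers.

(** * Vanishing derivatives and polynomials on the real axis *)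

Section Vanishing.
Context {R : realType} {n : nat}.
Local Notation C := (clifford R n).
Local Notation point := 'rV[R]_n.+1.

Lemma is_derive_near_eq0 (g : R -> C) (x : R) dg :
  (\forall y \near x, g y = 0) -> is_derive x (1 : R) g dg -> dg = 0.
Proof.
by move=> g0 [_ <-]; rewrite (@near_eq_derive _ _ _ g (fun=> 0))// derive_cst.
Qed.

(** The equation writes [S j k.+2] in terms of [S j.+1 k] and [S j.+2 k]: one order in [s] can be
    given up for two in [u]. Starting from order [m] in [s], where everything vanishes, [m]
    exchanges reach order [0]. *)
Lemma epd_tower_vanish (W : set (R * R)) c (S : nat -> nat -> R * R -> C) (m : nat) :
  open W -> epd_tower W c S -> (forall q, W q -> S m 0%N q = 0) ->
  forall k q, (m.*2 <= k)%N -> W q -> S 0%N k q = 0.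
Proof.
move=> Wo HS S0.
have nb q : W q -> exists2 e : R, ball q e q & ball q e `<=` W.
  move=> Wq; have /nbhs_ballP[e /= e0 sub] := open_nbhs_nbhs (conj Wo Wq).
  by exists e => //; exact: ballxx.
have stepu j k : (forall q, W q -> S j k q = 0) -> forall q, W q -> S j k.+1 q = 0.
  move=> Sjk q Wq; have [hu _ _] := HS j k q Wq; apply: is_derive_near_eq0 hu.
  by have [e qq sub] := nb q Wq; apply: filterS (near_ball_line_x qq) => t /sub/Sjk.
have steps j k : (forall q, W q -> S j k q = 0) -> forall q, W q -> S j.+1 k q = 0.
  move=> Sjk q Wq; have [_ hs _] := HS j k q Wq; apply: is_derive_near_eq0 hs.
  by have [e qq sub] := nb q Wq; apply: filterS (near_ball_line_y qq) => t /sub/Sjk.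
have Sm k : forall q, W q -> S m k q = 0 by elim: k => [//|k IH]; exact: stepu.
have Smj k i : forall q, W q -> S (m + i)%N k q = 0.
  elim: i => [|i IH]; first by rewrite addn0; exact: Sm.
  by rewrite addnS; exact: steps.
suff H i j k q : (m <= j + i)%N -> (i.*2 <= k)%N -> W q -> S j k q = 0.
  by move=> k q mk; apply: (H m) => //; rewrite add0n.
elim: i j k q => [|i IH] j k q.
  by rewrite addn0 => mj _; rewrite -(subnKC mj); exact: Smj.
move=> mj; case: k => [//|[//|k]]; rewrite doubleS !ltnS => ik Wq.
have [_ _] := HS j k q Wq.
have -> : S j.+1 k q = 0 by apply: IH; rewrite // addSnnS.
have -> : S j.+2 k q = 0.
  by apply: IH; rewrite // !addSn (leq_trans mj)// addnS leqnSn.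
by rewrite !scaler0 !add0r.
Qed.

Lemma open_sqrt_domain (U : set (R * R)) : open U -> open (sqrt_domain U).
Proof.
move=> Uo.
have c : continuous (fun q : R * R => (q.1, Num.sqrt q.2)).
  move=> q; apply: continuous_pair_fun; first exact: cvg_fst.
  apply: (@continuous_comp _ _ _ (fun q : R * R => q.2) Num.sqrt q).
    exact: cvg_snd.
  exact: sqrt_continuous.
have -> : sqrt_domain U = [set q : R * R | 0 < q.2] `&`
    (fun q : R * R => (q.1, Num.sqrt q.2)) @^-1` U by [].
apply: openI; last by apply: open_comp => // q _; exact: c.
rewrite (_ : [set q : R * R | _] = (fun q : R * R => q.2) @^-1` [set x | 0 < x])//.
apply: open_comp; last exact: open_gt.
by move=> q _; exact: cvg_snd.
Qed.

Lemma continuous_axial_coord : continuous (@axial_coord R n).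
Proof.
have cc (j : 'I_n.+1) : continuous (fun y : point => y ord0 j : R).
  exact: coord_continuous.
move=> x; apply: (@continuous_pair_fun _ _ x (fun y : point => y ord0 ord0)).
  exact: cc.
apply: continuous_bigsum => l.
rewrite (_ : (fun y => _) = fun y : point => y ord0 (lift ord0 l) * y ord0 (lift ord0 l)).
  by apply: (@continuous_scale_fun _ _ R (fun y : point => y ord0 (lift ord0 l))); exact: cc.
by apply/funext => y; rewrite expr2.
Qed.

End Vanishing.

Section RealPolynomial.
Context {R : realType} {n : nat}.
Local Notation C := (clifford R n).

Lemma polynomial_of_derivative (N : nat) (phi : nat -> R -> C) (u0 e : R) : 0 < e ->
  (forall k u, `|u - u0| < e -> is_derive u (1 : R) (phi k) (phi k.+1 u)) ->
  (forall u, `|u - u0| < e -> phi N u = 0) ->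
  exists a : nat -> C, forall u, `|u - u0| < e ->
    phi 0%N u = \sum_(k < N) u ^+ k *: a k.
Proof.
move=> e0; elim: N phi => [|N IH] phi dphi phi0.
  by exists (fun=> 0) => u /phi0 ->; rewrite big_ord0.
have [a Ha] := IH (fun k => phi k.+1) (fun k => dphi k.+1) phi0.
(* The difference between [phi 0] and an antiderivative of the polynomial found for [phi 1]; it is
   constant, and its value becomes the coefficient of degree [0]. *)
pose q u := phi 0%N u - \sum_(k < N) u ^+ k.+1 *: (k.+1%:R^-1 *: a k).
have dq u : `|u - u0| < e -> is_derive u (1 : R) q 0.
  move=> ue; rewrite -(subrr (phi 1%N u)) {2}(Ha _ ue).
  apply: is_derive_add; first exact: dphi.
  apply: is_derive_opp; apply: is_derive_bigsum => k _.
  have dX : is_derive u (1 : R) (fun u => u ^+ k.+1) (k.+1%:R * u ^+ k).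
    by apply: DeriveDef; [exact: exprn_derivable|rewrite -derive1E exp_derive1].
  have := is_derive_scale dX (is_derive_const (k.+1%:R^-1 *: a k) u 1).
  by rewrite scaler0 addr0 scalerA mulrAC mulfV ?mul1r.
have qc u : `|u - u0| < e -> q u = q u0.
  move=> ue; apply: coordP => A.
  apply: (@constant_of_derive0 _ (fun u => cliff_coord A (q u))) => x xu.
  rewrite -(linear0 (cliff_coord A)); apply: is_derive_coord; apply: dq.
  exact: le_lt_trans ue.
exists (fun k => if k is k'.+1 then k'.+1%:R^-1 *: a k' else q u0) => u ue.
rewrite big_ord_recl expr0 scale1r /= -(qc u ue) /q.
by rewrite addrNK.
Qed.

End RealPolynomial.

(** * Polynomials are holomorphic on slices *)

Section SlicePolynomial.
Context {R : realType} {n : nat}.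
Local Notation C := (clifford R n).
Variables (U : set (R * R)) (J : C).
Hypotheses (Uo : open U) (J2 : J * J = -1).

Let X (p : R * R) : C := p.1%:A + p.2 *: J.

(** The product rule survives noncommutativity because [X = u + v J] commutes with [J] and
    multiplies on the left. *)
Lemma slice_holomorphicX g g' : slice_holomorphic U J g g' ->
  slice_holomorphic U J (fun p => X p * g p) (fun p => g p + X p * g' p).
Proof.
move=> H p Up; have [gx gy gc'] := H p Up.
have gc := slice_holomorphic_continuous Uo J2 H Up.
have EX (h : C) q : X q * h = q.1 *: h + q.2 *: (J * h).
  by rewrite /X mulrDl -scalerAl mul1r -scalerAl.
split.
- have H1 := is_derive_add (is_derive_scale (is_derive_id p.1 1) gx)
    (is_derive_scalec p.2 (is_derive_lmul J gx)).
  have E : (fun t => t *: g (t, p.2) + p.2 *: (J * g (t, p.2))) =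
      (fun t => X (t, p.2) * g (t, p.2)).
    by apply/funext => t; rewrite EX.
  rewrite /= E in H1; apply: is_derive_eq H1 _.
  by rewrite scale1r -surjective_pairing -addrA -EX.
- have H1 := is_derive_add (is_derive_scalec p.1 gy)
    (is_derive_scale (is_derive_id p.2 1) (is_derive_lmul J gy)).
  have E : (fun t => p.1 *: g (p.1, t) + t *: (J * g (p.1, t))) =
      (fun t => X (p.1, t) * g (p.1, t)).
    by apply/funext => t; rewrite EX.
  rewrite /= E in H1; apply: is_derive_eq H1 _.
  by rewrite scale1r -surjective_pairing addrCA mulrDr EX mulrDr !scalerAr.
- have Jc := @continuous_lmul _ _ _ J g' p gc'.
  have H1 : {for p, continuous (fun q : R * R => q.1 *: g' q + q.2 *: (J * g' q))}.
    have c1 := @continuous_scale_fun _ _ _ (fun q : R * R => q.1) g' p cvg_fst gc'.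
    have c2 := @continuous_scale_fun _ _ _ (fun q : R * R => q.2) _ p cvg_snd Jc.
    by apply: cvgD; [exact: c1|exact: c2].
  have E : (fun q : R * R => q.1 *: g' q + q.2 *: (J * g' q)) = (fun q => X q * g' q).
    by apply/funext => q; rewrite EX.
  by rewrite E in H1; apply: cvgD; [exact: gc|exact: H1].
Qed.

Lemma slice_holomorphic_const (c : C) : slice_holomorphic U J (fun=> c) (fun=> 0).
Proof.
move=> p Up; split; first exact: is_derive_const.
  by rewrite mulr0; exact: is_derive_const.
exact: continuous_constant.
Qed.

Lemma slice_holomorphicD g g' h h' :
  slice_holomorphic U J g g' -> slice_holomorphic U J h h' ->
  slice_holomorphic U J (fun p => g p + h p) (fun p => g' p + h' p).
Proof.
move=> Hg Hh p Up; have [gx gy gc] := Hg p Up; have [hx hy hc] := Hh p Up; split.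
- exact: is_derive_add.
- by rewrite mulrDr; exact: is_derive_add.
- exact: cvgD.
Qed.

Lemma slice_holomorphic_polynomial (N : nat) (a : nat -> C) : exists g',
  slice_holomorphic U J (fun p => \sum_(k < N) X p ^+ k * a k) g'.
Proof.
elim: N => [|N [g' IH]].
  exists (fun=> 0); rewrite (_ : (fun p => _) = fun=> 0); first exact: slice_holomorphic_const.
  by apply/funext => p; rewrite big_ord0.
have [h' Hh'] : exists h', slice_holomorphic U J (fun p => X p ^+ N * a N) h'.
  move: (a N) => c; elim: (N) => [|k [h' Hh']].
    exists (fun=> 0); rewrite (_ : (fun p => _) = fun=> c); first exact: slice_holomorphic_const.
    by apply/funext => p; rewrite expr0 mul1r.
  exists (fun p => X p ^+ k * c + X p * h' p); rewrite (_ : (fun p => _) = fun p => X p * (X p ^+ k * c)).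
    exact: slice_holomorphicX Hh'.
  by apply/funext => p; rewrite exprS mulrA.
exists (fun p => g' p + h' p).
rewrite (_ : (fun p => _) = fun p => \sum_(k < N) X p ^+ k * a k + X p ^+ N * a N).
  exact: slice_holomorphicD.
by apply/funext => p; rewrite big_ord_recr.
Qed.

End SlicePolynomial.

(** * Polynomials *)

Section Converse.
Context {R : realType} {n : nat}.
Local Notation C := (clifford R n).
Local Notation point := 'rV[R]_n.+1.
Implicit Types (g : point -> C).

(* Equivalently, [g] is a polynomial of degree less than [d] in the real      *)
(* coordinates.                                                               *)
Fixpoint deg_lt (d : nat) g : Prop :=
  if d is d'.+1 then
    forall i, exists2 g', (forall x, is_derive x (basis_vec i) g (g' x)) & deg_lt d' g'
  else forall x, g x = 0.

Lemma deg_lt_const0 d : deg_lt d (fun=> 0).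
Proof.
elim: d => [//|d IH] i; exists (fun=> 0) => // x; exact: is_derive_const.
Qed.

Lemma deg_lt_ext d g h : (forall x, g x = h x) -> deg_lt d g -> deg_lt d h.
Proof. by move=> /funext ->. Qed.

Lemma deg_ltS d g : deg_lt d g -> deg_lt d.+1 g.
Proof.
elim: d g => [|d IH] g Hg i.
  exists (fun=> 0) => // x; rewrite (_ : g = fun=> 0); first exact: is_derive_const.
  exact/funext.
by have [g' dg Hg'] := Hg i; exists g' => //; exact: IH.
Qed.

Lemma deg_lt_le d e g : (d <= e)%N -> deg_lt d g -> deg_lt e g.
Proof.
move=> /subnK <-; elim: (e - d)%N => [//|k IH] Hg.
by rewrite addSn; apply: deg_ltS; exact: IH.
Qed.

Lemma deg_ltD d g h : deg_lt d g -> deg_lt d h -> deg_lt d (fun x => g x + h x).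
Proof.
elim: d g h => [|d IH] g h Hg Hh; first by move=> x; rewrite Hg Hh addr0.
move=> i; have [g' dg Hg'] := Hg i; have [h' dh Hh'] := Hh i.
by exists (fun x => g' x + h' x); [move=> x; exact: is_derive_add|exact: IH].
Qed.

Lemma deg_lt_sum d (I : Type) (r : seq I) (G : I -> point -> C) :
  (forall i, deg_lt d (G i)) -> deg_lt d (fun x => \sum_(i <- r) G i x).
Proof.
move=> H; elim: r => [|i r IH].
  by apply: deg_lt_ext (deg_lt_const0 d) => x; rewrite big_nil.
by apply: deg_lt_ext (deg_ltD (H i) IH) => x; rewrite big_cons.
Qed.

Lemma deg_lt_lmul d (c : C) g : deg_lt d g -> deg_lt d (fun x => c * g x).
Proof.
elim: d g => [|d IH] g Hg; first by move=> x; rewrite Hg mulr0.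
move=> i; have [g' dg Hg'] := Hg i.
by exists (fun x => c * g' x); [move=> x; exact: is_derive_lmul|exact: IH].
Qed.

Lemma is_derive_paravector_mul g g' x i : is_derive x (basis_vec i) g (g' x) ->
  is_derive x (basis_vec i) (fun y => paravector y * g y)
    (paravector (basis_vec i) * g x + paravector x * g' x).
Proof.
move=> dg.
have E y (c : C) : paravector y * c = y ord0 ord0 *: c +
    \sum_(l < n) y ord0 (lift ord0 l) *: (gen l * c).
  rewrite /paravector mulrDl -scalerAl mul1r mulr_suml; congr (_ + _).
  by apply: eq_bigr => l _; rewrite -scalerAl.
have H := is_derive_add (is_derive_scale (is_derive_coord_fun i ord0 x) dg)
  (@is_derive_bigsum _ _ _ _ (index_enum 'I_n) xpredT _ x (basis_vec i) _
    (fun l _ => is_derive_scale (is_derive_coord_fun i (lift ord0 l) x)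
      (is_derive_lmul (gen l) dg))).
have e : (fun y : point => y ord0 ord0 *: g y +
    \sum_(l < n) y ord0 (lift ord0 l) *: (gen l * g y)) = (fun y => paravector y * g y).
  by apply/funext => y; rewrite E.
rewrite e in H; apply: is_derive_eq H _.
rewrite !E big_split [LHS]addrACA; congr (_ + _).
congr (_ + _); first by rewrite mxE eqxx.
by apply: eq_bigr => l _; rewrite mxE eqxx.
Qed.

Lemma deg_lt_paravector d g : deg_lt d g -> deg_lt d.+1 (fun x => paravector x * g x).
Proof.
elim: d g => [|d IH] g Hg.
  by apply: (@deg_lt_ext 1 (fun=> 0)); [move=> x; rewrite Hg mulr0|exact: deg_lt_const0].
move=> i; have [g' dg Hg'] := Hg i.
exists (fun x => paravector (basis_vec i) * g x + paravector x * g' x).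
  by move=> x; exact: is_derive_paravector_mul.
by apply: deg_ltD; [exact: deg_lt_lmul|exact: IH].
Qed.

Lemma deg_lt_monomial k (c : C) : deg_lt k.+1 (fun x => paravector x ^+ k * c).
Proof.
elim: k => [|k IH].
  apply: (@deg_lt_ext _ (fun=> c)) => [x|i]; first by rewrite expr0 mul1r.
  by exists (fun=> 0) => // x; exact: is_derive_const.
by apply: deg_lt_ext (deg_lt_paravector IH) => x; rewrite exprS mulrA.
Qed.

Lemma deg_lt_laplacian d g (Omega : set point) : deg_lt d.+2 g ->
  exists2 L, deg_lt d L & is_laplacian Omega g L.
Proof.
move=> Hg; have [D HD] := choice (fun i => let: ex_intro2 g' a b := Hg i in
  ex_intro (fun g' => (forall x, is_derive x (basis_vec i) g (g' x)) /\ deg_lt d.+1 g')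
    g' (conj a b)).
have HE' i : exists E, (forall x, is_derive x (basis_vec i) (D i) (E x)) /\ deg_lt d E.
  by have [_ /(_ i)[E h1 h2]] := HD i; exists E.
have [E HE] := choice HE'.
exists (fun x => \sum_i E i x); first by apply: deg_lt_sum => i; have [] := HE i.
exists D, E => x _; split=> // i.
by have [h1 _] := HD i; have [h2 _] := HE i; split.
Qed.

Lemma iter_laplacian_deg_lt m (Omega : set point) f g : open Omega ->
  deg_lt m.*2 g -> (forall x, Omega x -> f x = g x) ->
  forall x, Omega x -> iter m laplacian f x = 0.
Proof.
move=> Oo; elim: m f g => [|m IH] f g Hg fg x Ox; first by rewrite /= fg.
have [L HL Hlap] := deg_lt_laplacian Omega Hg.
rewrite iterSr; apply: IH HL _ x Ox.
exact: is_laplacian_eq Oo Hlap fg.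
Qed.

End Converse.

(** * The Laplacian of the axial field *)

Section Forward.
Context {R : realType} {n : nat}.
Local Notation C := (clifford R n).
Local Notation point := 'rV[R]_n.+1.
Variables (U : set (R * R)) (alpha beta : nat -> R * R -> C).
Hypothesis Hab : axial_seq U alpha beta.
Let S := even_tower alpha beta.
Let T := odd_tower alpha beta.
Let W := sqrt_domain U.

Definition axial_field j (x : point) : C :=
  S j 0%N (axial_coord x) + vector_part x * T j 0%N (axial_coord x).

(** The even part has degree [0] in the vector part and constant [2]; each term of the odd part has
    degree [1] and constant [6]. Both give the same factor, as [- 2 = 4 - 6], so the field is
    reproduced with [j] raised by one. *)
Lemma is_laplacian_axial_field j :
  is_laplacian [set x | W (axial_coord x)] (axial_field j)
    (fun x => (2 * n%:R - 2 - 4 * j%:R) *: axial_field j.+1 x).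
Proof.
have E i : axial_field i = fun x => 1 *: S i 0%N (axial_coord x) +
    \sum_(l < n) x ord0 (lift ord0 l) *: (gen l * T i 0%N (axial_coord x)).
  apply/funext => x; rewrite /axial_field scale1r /vector_part mulr_suml.
  by congr (_ + _); apply: eq_bigr => l _; rewrite -scalerAl.
have HS : is_laplacian [set x | W (axial_coord x)]
    (fun x => 1 *: S j 0%N (axial_coord x))
    (fun x => (2 * n%:R + 4 * 0 - 2 - 4 * j%:R) *: (1 *: S j.+1 0%N (axial_coord x))).
  apply: (@is_laplacian_axial _ _ W 2 S (fun=> 1) (fun=> 0) 0).
  - exact: even_tower_epd.
  - by move=> x; rewrite mul0r big1// => l _; rewrite mul0r.
have HT l : is_laplacian [set x | W (axial_coord x)]
    (fun x => x ord0 (lift ord0 l) *: (gen l * T j 0%N (axial_coord x)))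
    (fun x => (2 * n%:R + 4 * 1 - 6 - 4 * j%:R) *:
      (x ord0 (lift ord0 l) *: (gen l * T j.+1 0%N (axial_coord x)))).
  apply: (@is_laplacian_axial _ _ W 6 (fun j k q => gen l * T j k q)
    (fun x => x ord0 (lift ord0 l)) (fun m => (lift ord0 l == lift ord0 m)%:R) 1).
  - by apply: epd_tower_lmul; exact: odd_tower_epd.
  - by move=> x; exact: is_derive_coord_fun.
  - by move=> x m; exact: is_derive_coord_fun.
  - move=> x; rewrite (bigD1 l) //= big1 => [|m ml]; first by rewrite eqxx addr0.
    by rewrite (inj_eq lift_inj) eq_sym (negbTE ml) mul0r.
have H := is_laplacianD HS (is_laplacian_sum (index_enum 'I_n) HT).
rewrite !E.
rewrite [X in is_laplacian _ _ X](_ : _ = fun x =>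
  (2 * n%:R + 4 * 0 - 2 - 4 * j%:R) *: (1 *: S j.+1 0%N (axial_coord x)) +
  \sum_(l < n) (2 * n%:R + 4 * 1 - 6 - 4 * j%:R) *:
    (x ord0 (lift ord0 l) *: (gen l * T j.+1 0%N (axial_coord x))))//.
apply/funext => x; rewrite scalerDr scaler_sumr; congr (_ *: _ + _); first by ring.
by apply: eq_bigr => l _; congr (_ *: _); ring.
Qed.

End Forward.

(** * The kernel of the power of the Laplacian *)

Section Main.
Context {R : realType} {n : nat}.
Local Notation C := (clifford R n).
Local Notation point := 'rV[R]_n.+1.
Variables (Omega : set point) (f : point -> C).
Hypotheses (hOmega : axially_symmetric_slice_domain Omega)
  (hf : slice_monogenic Omega f).

Lemma laplacian_kernel_even_part (m : nat) (I : point) alpha beta :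
  n = m.*2.+1 -> unit_sphere I -> axial_seq (slice Omega I) alpha beta ->
  (forall J p, unit_sphere J -> slice Omega I p ->
    f (slice_pt J p.1 p.2) = alpha 0%N p + paravector J * beta 0%N p) ->
  (forall x, Omega x -> iter m laplacian f x = 0) ->
  forall q, sqrt_domain (slice Omega I) q -> even_tower alpha beta m 0%N q = 0.
Proof.
move=> nm SI Hab rep lap0.
set U := slice Omega I in Hab rep *; set W := sqrt_domain U.
case: (hOmega) => _ _ dom _; have [Uo _ _] := dom I SI.
have Wo : open W by exact: open_sqrt_domain.
pose O := [set x : point | W (axial_coord x)].
have Oo : open O by apply: open_comp Wo => x _; exact: continuous_axial_coord.
have polar x : O x -> Omega x /\ f x = axial_field alpha beta 0 x.
  move=> [/= x0 Ux]; have [J [SJ xE pJ]] := slice_pt_polar x0.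
  rewrite {1}xE; split.
    by move: Ux; rewrite /U (slice_indep hOmega SI SJ).
  rewrite {1}xE (rep J (x ord0 ord0, Num.sqrt (im_sqr x)) SJ Ux) pJ.
  by rewrite /axial_field /= -scalerAl scalerAr.
have F0 x : O x -> axial_field alpha beta m x = 0.
  move=> Ox; have [Omx _] := polar x Ox.
  have := lap0 x Omx.
  rewrite (iter_is_laplacian Oo (fun x Ox => (polar x Ox).2)
    (is_laplacian_axial_field Hab) m Ox).
  (* The product of the constants is nonzero: for [n = 2 m + 1] its factors are [4 (m - j)] with
     [j < m]. *)
  move=> /eqP; rewrite scaler_eq0 => /orP[|/eqP//].
  rewrite prodf_seq_eq0 => /hasP[j _ /=].
  have -> : n%:R = 2 * m%:R + 1 :> R by rewrite {1}nm -addn1 natrD -muln2 natrM mulrC.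
  have -> : 2 * (2 * m%:R + 1) - 2 - 4 * j%:R = 4 * (m - j)%N%:R :> R.
    by rewrite natrB; [ring|exact: ltnW].
  by rewrite mulf_eq0 !pnatr_eq0 subn_eq0 leqNgt ltn_ord.
move=> [u s] [/= s0 Uus].
have sq2 : Num.sqrt s ^+ 2 = s by rewrite sqr_sqrtr// ltW.
have onS J : unit_sphere J -> axial_coord (slice_pt J u (Num.sqrt s)) = (u, s).
  by move=> SJ; rewrite /axial_coord slice_pt_re// im_sqr_slice_pt// sq2.
have OJ J : unit_sphere J -> O (slice_pt J u (Num.sqrt s)).
  by move=> SJ; rewrite /O /= onS.
have SNI := unit_sphere_opp SI.
(* The points [u + I v] and [u - I v] have the same [(u, s)] and opposite vector parts, so adding
   the two equations leaves twice the even part. *)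
have := F0 _ (OJ I SI); have := F0 _ (OJ (- I) SNI).
rewrite /axial_field !onS//.
have -> : vector_part (slice_pt (- I) u (Num.sqrt s)) =
    - vector_part (slice_pt I u (Num.sqrt s)) :> C.
  rewrite /vector_part -sumrN; apply: eq_bigr => l _.
  by rewrite !slice_pt_im mxE mulrN scaleNr.
rewrite mulNr => /eqP; rewrite subr_eq0 => /eqP <-.
rewrite -mulr2n -scaler_nat => /eqP; rewrite scaler_eq0 pnatr_eq0 /=.
by move=> /eqP.
Qed.

Lemma laplacian_kernel_polynomial (m : nat) : n = m.*2.+1 ->
  (forall x, Omega x -> iter m laplacian f x = 0) ->
  exists a : nat -> C, forall x, Omega x ->
    f x = \sum_(k < m.*2) paravector x ^+ k * a k.
Proof.
move=> nm lap0.
have n0 : (0 < n)%N by rewrite nm.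
pose I : point := basis_vec (lift ord0 (Ordinal n0)).
have SI : unit_sphere I by exact: unit_sphere_basis.
have [alpha [beta [Hab rep]]] := slice_representation hOmega hf SI.
have S0 := laplacian_kernel_even_part nm SI Hab rep lap0.
set U := slice Omega I in Hab rep S0.
case: (hOmega) => _ [u0 Ou0] dom _; have [Uo Uc _] := dom I SI.
have Uu0 : U (u0, 0) by rewrite /U /slice /slice_pt /= scale0r addr0.
have Wo := open_sqrt_domain Uo.
(* The towers live over [s > 0] only. There [epd_tower_vanish] kills the [2 m]-th [u]-derivative,
   and continuity of [alpha] extends this to [v = 0]. *)
have alpha0 (u : R) : U (u, 0) -> alpha m.*2 (u, 0) = 0.
  move=> Uu; have [_ [ac _]] := Hab m.*2 (u, 0) Uu.
  have c0 : {for (0 : R), continuous (fun t => alpha m.*2 (u, t))}.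
    apply: (@continuous_comp _ _ _ (fun t : R => (u, t)) (alpha m.*2) (0 : R) _ ac).
    by apply: continuous_pair_fun; [exact: cvg_cst|exact: cvg_id].
  have c1 : alpha m.*2 (u, t) @[t --> (0 : R)^'+] --> alpha m.*2 (u, 0).
    exact: cvg_at_right_filter c0.
  have U0 : \forall t \near (0 : R)^'+, U (u, t).
    have /nbhs_ballP[e /= e0 H] := open_nbhs_nbhs (conj Uo Uu).
    have zz : ball (u, 0 : R) e (u, 0 : R) by exact: ballxx.
    by apply: cvg_within; apply: filterS (near_ball_line_y zz) => t /H.
  have c2 : alpha m.*2 (u, t) @[t --> (0 : R)^'+] --> (0 : C).
    apply: cvg_near_cst; near=> t.
    have t0 : 0 < t by near: t; exact: nbhs_right_gt.
    have Ut : U (u, t) by near: t.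
    have := epd_tower_vanish Wo (even_tower_epd Hab) S0 (k := m.*2) (q := (u, t ^+ 2)).
    rewrite /even_tower /= sqrtr_sqr gtr0_norm//; apply=> //.
    by split; rewrite /= ?exprn_gt0// sqrtr_sqr gtr0_norm.
  exact: cvg_unique c1 c2.
have [e e0 He] : exists2 e : R, 0 < e & forall u, `|u - u0| < e -> U (u, 0).
  have /nbhs_ballP[e /= e0 H] := open_nbhs_nbhs (conj Uo Uu0).
  exists e => // u ue; apply: H; apply/ball_pairP; rewrite /= subrr normr0.
  by rewrite distrC.
have [a Ha] := @polynomial_of_derivative _ _ m.*2 (fun k u => alpha k (u, 0)) u0 e e0
  (fun k u ue => let: conj (And4 h _ _ _) _ := Hab k (u, 0) (He u ue) in h)
  (fun u ue => alpha0 u (He u ue)).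
have on_slice J p : unit_sphere J -> U p ->
    f (slice_pt J p.1 p.2) = \sum_(k < m.*2) paravector (slice_pt J p.1 p.2) ^+ k * a k.
  move=> SJ Up; have J2 := @unit_sphere_sqr _ _ _ SJ.
  have [h' Hh'] := slice_monogenic_holomorphic hf SJ.
  rewrite (slice_indep hOmega SJ SI) -/U in Hh'.
  have [g' Hg'] := slice_holomorphic_polynomial Uo J2 m.*2 a.
  have Hd := slice_holomorphicB Hh' Hg'.
  rewrite paravector_slice_pt//; apply/eqP; rewrite -subr_eq0; apply/eqP.
  apply: (slice_holomorphic_identity Uo J2 Uc Hd Uu0 _ Up).
  exists e => //= u; rewrite /ball_/= distrC => ue.
  rewrite /slice_restriction /= (_ : slice_pt J u 0 = slice_pt J (u, 0 : R).1 (u, 0 : R).2)//.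
  have E1 := rep J _ SJ (He u ue).
  (* A real point lies on the slices of both [J] and [- J]; comparing the two representations shows
     that the term in [beta] vanishes, so [f = alpha] there. *)
  have E2 := rep (- J) _ (unit_sphere_opp SJ) (He u ue).
  have Jb : paravector J * beta 0%N (u, 0) = 0.
    have PN : paravector (- J) = - paravector J :> C.
      rewrite /paravector mxE scaleNr opprD; congr (_ + _).
      by rewrite -sumrN; apply: eq_bigr => l _; rewrite mxE scaleNr.
    have : f (slice_pt J u 0) = f (slice_pt (- J) u 0) by rewrite /slice_pt !scale0r.
    rewrite E1 E2 PN mulNr => /addrI/eqP; rewrite -addr_eq0 -mulr2n -scaler_nat.
    by rewrite scaler_eq0 pnatr_eq0 /= => /eqP.
  rewrite E1 Jb addr0 Ha// -sumrB big1// => k _.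
  by rewrite scale0r addr0 exprZn expr1n -scalerAl mul1r subrr.
(* A real point has no direction of its own, so the fixed unit [I] serves for it; any other point
   determines its [J]. *)
exists a => x Ox; have [x0|x0] := eqVneq (im_sqr x) 0.
  have xE := slice_pt_real I x0.
  rewrite xE (on_slice I (x ord0 ord0, 0) SI)//.
  by rewrite /U /slice /= -xE.
have {}x0 : 0 < im_sqr x by rewrite lt_neqAle eq_sym x0 sumr_ge0// => l _; exact: sqr_ge0.
have [J [SJ xE _]] := slice_pt_polar x0.
rewrite xE (on_slice J (x ord0 ord0, Num.sqrt (im_sqr x)) SJ)//.
by rewrite /U (slice_indep hOmega SI SJ) /slice /= -xE.
Unshelve. all: by end_near. Qed.

End Main.

Unset Implicit Arguments.

Theorem theorem4p7 (R : realType) (n : nat) (hn : odd n)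
    (Omega : set 'rV[R]_n.+1) (hOmega : axially_symmetric_slice_domain Omega)
    (f : 'rV[R]_n.+1 -> clifford R n) (hf : slice_monogenic Omega f) :
  (forall x, Omega x -> iter (n.-1)./2 laplacian f x = 0) <->
  (exists a : 'I_n.-1 -> clifford R n,
     forall x, Omega x -> f x = \sum_(k < n.-1) paravector x ^+ k * a k).
Proof.
(* Oddness makes the halving exact. For [n = 1] the power of the Laplacian is the identity and the
   sum is empty. *)
have nm : n = (n.-1./2).*2.+1.
  by case: n hn {Omega hOmega f hf} => [//|k] /= ok; rewrite even_halfK.
have nm1 : n.-1 = (n.-1./2).*2 by rewrite {1}nm.
split=> [lap0|[a Ha] x Ox].
  have [a Ha] := laplacian_kernel_polynomial hOmega hf nm lap0.
  by exists (fun k => a k) => x Ox; rewrite Ha// -nm1.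
case: (hOmega) => -[Oo _ _] _ _ _.
apply: (iter_laplacian_deg_lt Oo _ Ha Ox); rewrite -nm1.
apply: deg_lt_sum => k; apply: deg_lt_le (deg_lt_monomial k (a k)).
exact: ltn_ord.
Qed.
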